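(* Let $W$ be an irreducible affine Weyl group with set of simple reflections $S$ ($|S|\ge 2$), let $s_0\in S$ be special, let $W_0=\langle S\setminus\{s_0\}\rangle$ with longest element $M_0$, and let $L:W\to\mathbf N$ be a weight function with $L(s)>0$ for all $s\in S$. With $H$, $Q^+$, $M_x$, $\mathbf c_x$, $N_{w,w',w'';L}$, $J$, $J_*$ as defined in the context, the following hold. (a) For $x,y$ in $Q^+$ we have $$\mathbf c_x\mathbf c_y=\sum_{z\in Q^+}N_{M_x,M_y,M_z;L}\,\mathbf c_z .$$ (b) The subgroup $R$ of $H$ with $\mathbf Z$-basis $\{\mathbf c_x;\ x\in Q^+\}$ is closed under multiplication in $H$. (c) The isomorphism of abelian groups $R\to J_*$ given by $\mathbf c_x\mapsto\tau_{M_x}$ $(x\in Q^+)$ is compatible with the multiplication. In particular, the multiplication in $J_*$ is associative.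
   Context: Affine Weyl group: $|w|$ denotes the length of $w\in W$ with respect to $S$. $Q$ is the subgroup of translations in $W$, that is, the set of all $t\in W$ whose $W$-conjugacy class is finite; it is a normal free abelian subgroup of finite index. An element $s_0\in S$ is special if $W$ is generated by $Q$ and the finite subgroup $W_0$ generated by $S_0=S\setminus\{s_0\}$. Set $Q^+=\{x\in Q;\ |sx|=|x|+1 \text{ for all } s\in S_0\}$. Then $W=\bigsqcup_{x\in Q^+}W_0xW_0$. For $x\in Q^+$, $M_x$ is the unique element of maximal length in $W_0xW_0$; in particular $M_0$ (the case where $x$ is the neutral element of $Q$, written $0$) is the longest element of $W_0$. Weight function: $L:W\to\mathbf N$ is a weight function if $L(ww')=L(w)+L(w')$ whenever $|ww'|=|w|+|w'|$. Hecke algebra: $v$ is an indeterminate and $\mathcal A=\mathbf Z[v,v^{-1}]$. $H$ is the associative $\mathbf Q(v)$-algebra with basis $\{T_w;\ w\in W\}$ and multiplication determined by $T_wT_{w'}=T_{ww'}$ if $|ww'|=|w|+|w'|$ and $(T_s+v^{-L(s)})(T_s-v^{L(s)})=0$ for $s\in S$. Let $\bar{\ }:H\to H$ be the ring involution with $\overline{v^n}=v^{-n}$ and $\overline{T_w}=T_{w^{-1}}^{-1}$. For $w\in W$, $c_w$ is the unique element of $H$ with $\overline{c_w}=c_w$ and $c_w\in T_w+\sum_{y\ne w}v^{-1}\mathbf Z[v^{-1}]T_y$ (finite sum); $\{c_w;\ w\in W\}$ is a basis of $H$ and also an $\mathcal A$-basis of the subring $H_{\mathcal A}=\sum_w\mathcal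 A T_w$. Set $\pi_L=\sum_{e\in W_0}v^{2L(e)}$ and, for $x\in Q^+$, $\mathbf c_x=\dfrac{v^{L(M_0)}}{\pi_L}\,c_{M_x}\in H$. The integers $N_{w,w',w'';L}$: for $w,w'\in W$ write $c_wc_{w'}=\sum_{w''\in W}h_{w,w',w''}c_{w''}$ (finite sum, $h_{w,w',w''}\in\mathcal A$). It is quoted as known that $T_wT_{w'}\in v^{L(M_0)}\sum_{w''\in W}\mathbf Z[v^{-1}]T_{w''}$ for all $w,w'\in W$, and from this that $h_{w,w',w''}\in v^{L(M_0)}\mathbf Z[v^{-1}]$; $N_{w,w',w'';L}\in\mathbf Z$ is the coefficient of $v^{L(M_0)}$ in $h_{w,w',w''}$. The groups $J$ and $J_*$: $J$ is the free abelian group with basis $\{\tau_w;\ w\in W\}$, with the bilinear multiplication $\tau_w\tau_{w'}=\sum_{w''\in W}N_{w,w',w'';L}\,\tau_{w''}$ (finite sum), whose associativity is not assumed. $J_*$ is the subgroup of $J$ with basis $\{\tau_{M_x};\ x\in Q^+\}$; it is closed under the multiplication of $J$, with $\tau_{M_x}\tau_{M_y}=\sum_{z\in Q^+}N_{M_x,M_y,M_z;L}\,\tau_{M_z}$ (finite sum).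
   Formalization: The quoted bound that every T_wT_{w'} lies in v^{L(M_0)} times the Z[v^{-1}]-span of the T_{w''} is taken as a hypothesis; it fails, and so does (a), e.g. in the infinite dihedral case when L(s_0) exceeds L of the other simple reflection. *)

(* Defs.v *)
From HB Require Import structures.
From mathcomp Require Import all_boot all_order all_algebra.
From mathcomp Require Import boolp classical_sets functions cardinality fsbigop.
From mathcomp Require Import reals.
From mathcomp Require Export freeg.

Set Implicit Arguments.
Unset Strict Implicit.
Unset Printing Implicit Defensive.

Import Order.TTheory GRing.Theory Num.Theory.

Local Open Scope classical_set_scope.
Local Open Scope ring_scope.

(** * Families, finite linear combinations, coordinates *)

(* [\sum_(i \in D) F i] is 0 by convention when F has infinite support on D,
   so finiteness of the support is always required separately. *)
Definition finsupp_on (I : Type) (V : nmodType) (D : set I) (a : I -> V) : Prop :=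
  finite_set (D `&` [set i | a i != 0]).

Definition Zspan (I : choiceType) (V : zmodType) (D : set I) (e : I -> V) :
    set V :=
  [set x | exists2 a : I -> int,
     finsupp_on D a & x = \sum_(i \in D) (e i *~ a i)].

Definition Zfree (I : choiceType) (V : zmodType) (D : set I) (e : I -> V) : Prop :=
  forall a : I -> int, finsupp_on D a ->
    \sum_(i \in D) (e i *~ a i) = 0 -> forall i, D i -> a i = 0.

Definition coords_spec (K : fieldType) (V : lmodType K) (I : choiceType)
    (e : I -> V) (x : V) : set (I -> K) :=
  [set a | finsupp_on [set: I] a /\ x = \sum_(i \in [set: I]) (a i *: e i)].

Definition is_basis (K : fieldType) (V : lmodType K) (I : choiceType)
    (e : I -> V) : Prop :=
  forall x, exists! a, coords_spec e x a.

(* The coordinates of x in e; meaningful when e is a basis. *)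
Definition coords (K : fieldType) (V : lmodType K) (I : choiceType)
    (e : I -> V) (x : V) : I -> K :=
  xget (fun=> 0) (coords_spec e x).

(** * Root systems in Euclidean space and affine Weyl groups *)

Definition dot (R : realType) (n : nat) (u w : 'rV[R]_n) : R :=
  \sum_(i < n) u 0 i * w 0 i.

Definition coroot (R : realType) (n : nat) (a : 'rV[R]_n) : 'rV[R]_n :=
  (2 / dot a a) *: a.

(* The orthogonal reflection in the hyperplane (u, a) = k. *)
Definition affine_reflection (R : realType) (n : nat) (a : 'rV[R]_n) (k : int)
    (u : 'rV[R]_n) : 'rV[R]_n :=
  u - (dot u a - k%:~R) *: coroot a.

Record root_system (R : realType) (n : nat) (Phi : set 'rV[R]_n) : Prop := {
  rs_finite : finite_set Phi;
  rs_nonzero : forall a, Phi a -> a != 0;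
  rs_span : forall u : 'rV[R]_n,
    exists k : 'rV[R]_n -> R, u = \sum_(a \in Phi) (k a *: a);
  rs_reduced : forall a (t : R), Phi a -> Phi (t *: a) -> t = 1 \/ t = -1;
  rs_reflection : forall a b, Phi a -> Phi b -> Phi (affine_reflection a 0 b);
  rs_integral : forall a b, Phi a -> Phi b ->
    exists m : int, dot b (coroot a) = m%:~R }.

Definition irreducible_root_system (R : realType) (n : nat)
    (Phi : set 'rV[R]_n) : Prop :=
  [/\ root_system Phi, Phi !=set0 &
    ~ exists P1 P2 : set 'rV[R]_n,
      [/\ P1 !=set0, P2 !=set0, Phi = P1 `|` P2 &
          forall a b, P1 a -> P2 b -> dot a b = 0]].

(* The family delta is a base (simple system) of Phi. *)
Definition root_base (R : realType) (n : nat) (Phi : set 'rV[R]_n)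
    (delta : 'I_n -> 'rV[R]_n) : Prop :=
  [/\ \matrix_(i < n) delta i \in unitmx,
      forall i, Phi (delta i) &
      forall a, Phi a -> exists m : 'I_n -> nat,
        a = \sum_(i < n) (delta i *+ m i) \/ a = - \sum_(i < n) (delta i *+ m i)].

Definition highest_root (R : realType) (n : nat) (Phi : set 'rV[R]_n)
    (delta : 'I_n -> 'rV[R]_n) (theta : 'rV[R]_n) : Prop :=
  Phi theta /\ forall b, Phi b ->
    exists m : 'I_n -> nat, theta = b + \sum_(i < n) (delta i *+ m i).

Definition is_subgroup (W : groupType) (G : set W) : Prop :=
  [/\ G 1%g, forall x y, G x -> G y -> G (x * y)%g &
      forall x, G x -> G (x^-1)%g].

Definition generated (W : groupType) (A : set W) : set W :=
  smallest (@is_subgroup W) A.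

(* rho identifies W with the group generated by the affine reflections of Phi,
   and S with the reflections in the walls of the fundamental alcove
   { u | (u, delta_i) > 0 for all i, (u, theta) < 1 }. *)
Record affine_weyl_realization (R : realType) (W : groupType) (S : set W)
    (n : nat) (Phi : set 'rV[R]_n) (delta : 'I_n -> 'rV[R]_n)
    (theta : 'rV[R]_n) (rho : W -> 'rV[R]_n -> 'rV[R]_n) : Prop := {
  awr_one : forall u, rho 1%g u = u;
  awr_mul : forall x y u, rho (x * y)%g u = rho x (rho y u);
  awr_inj : injective rho;
  awr_refl : forall a (k : int), Phi a -> exists w, rho w = affine_reflection a k;
  awr_gen : generated
    [set w | exists a (k : int), Phi a /\ rho w = affine_reflection a k] = setT;
  awr_simple : forall s, S s <->
    (exists i, rho s = affine_reflection (delta i) 0)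
    \/ rho s = affine_reflection theta 1 }.

Definition irreducible_affine_weyl_group (R : realType) (W : groupType)
    (S : set W) : Prop :=
  exists (n : nat) (Phi : set 'rV[R]_n) (delta : 'I_n -> 'rV[R]_n)
         (theta : 'rV[R]_n) (rho : W -> 'rV[R]_n -> 'rV[R]_n),
    [/\ irreducible_root_system Phi, root_base Phi delta,
        highest_root Phi delta theta &
        affine_weyl_realization S Phi delta theta rho].

(** * Length, translations, double cosets *)

Definition is_word_length (W : groupType) (S : set W) (w : W) (k : nat) : Prop :=
  exists s : seq W, [/\ forall x, x \in s -> S x, w = (\prod_(x <- s) x)%g &
                        size s = k].

(* The elements of S are involutions, so words in S suffice. *)
Definition len (W : groupType) (S : set W) (w : W) : nat :=
  xget 0%N [set k | is_word_length S w k /\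
                    forall j, is_word_length S w j -> (k <= j)%N].

Definition translations (W : groupType) : set W :=
  [set t | finite_set [set (g^-1 * t * g)%g | g in [set: W]]].

Definition parabolic0 (W : groupType) (S : set W) (s0 : W) : set W :=
  generated (S `\ s0).

Definition special (W : groupType) (S : set W) (s0 : W) : Prop :=
  S s0 /\ generated (@translations W `|` parabolic0 S s0) = setT.

Definition Qplus (W : groupType) (S : set W) (s0 : W) : set W :=
  [set x | translations x /\
           forall s, (S `\ s0) s -> len S (s * x)%g = (len S x).+1].

Definition double_coset (W : groupType) (S : set W) (s0 x : W) : set W :=
  [set w | exists a b,
     [/\ parabolic0 S s0 a, parabolic0 S s0 b & w = (a * x * b)%g]].

Definition Mmax (W : groupType) (S : set W) (s0 x : W) : W :=
  xget 1%g [set m | double_coset S s0 x m /\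
                    forall w, double_coset S s0 x w -> (len S w <= len S m)%N].

Definition weight_function (W : groupType) (S : set W) (L : W -> nat) : Prop :=
  forall x y, len S (x * y)%g = (len S x + len S y)%N ->
    L (x * y)%g = (L x + L y)%N.

(** * Q(v) and Laurent polynomials *)

Notation Qv := {fraction {poly rat}}.

Definition v : Qv := tofrac 'X.

(* The Laurent polynomials in Z[v, v^-1] with exponents in D. *)
Definition laurent (D : set int) : set Qv := Zspan D (fun n : int => v ^ n).

Definition laurent_coef (f : Qv) : int -> int :=
  xget (fun=> 0) [set a | finsupp_on [set: int] a /\
                          f = \sum_(n \in [set: int]) (v ^ n *~ a n)].

(** * The Hecke algebra *)

(* The multiplication rules determine the structure constants in the basis T;
   in particular they force T 1 to be the unit of H. *)
Record hecke_algebra (W : groupType) (S : set W) (L : W -> nat)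
    (H : algType Qv) (T : W -> H) : Prop := {
  hecke_basis : is_basis T;
  hecke_mul : forall x y, len S (x * y)%g = (len S x + len S y)%N ->
    T x * T y = T (x * y)%g;
  hecke_quad : forall s, S s ->
    (T s + (v ^- L s)%:A) * (T s - (v ^+ L s)%:A) = 0 }.

Record bar_involution (W : groupType) (H : algType Qv) (T : W -> H)
    (bar : {rmorphism H -> H}) : Prop := {
  bar_invol : involutive bar;
  bar_v : forall n : int, bar (v ^ n)%:A = (v ^ (- n))%:A;
  bar_T : forall w, bar (T w) * T (w^-1)%g = 1 /\ T (w^-1)%g * bar (T w) = 1 }.

Definition canonical_element (W : groupType) (H : algType Qv) (T : W -> H)
    (bar : {rmorphism H -> H}) (w : W) (h : H) : Prop :=
  bar h = h /\
  exists p : W -> Qv,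
    [/\ finsupp_on [set~ w] p,
        forall y, y != w -> laurent [set n | n < 0] (p y) &
        h = T w + \sum_(y \in [set~ w]) (p y *: T y)].

Definition poincare (W : groupType) (S : set W) (s0 : W) (L : W -> nat) : Qv :=
  \sum_(e \in parabolic0 S s0) v ^+ (2 * L e)%N.

Definition cbold (W : groupType) (S : set W) (s0 : W) (L : W -> nat)
    (H : algType Qv) (c : W -> H) (x : W) : H :=
  (v ^+ L (Mmax S s0 1%g) / poincare S s0 L) *: c (Mmax S s0 x).

Definition hcoef (W : groupType) (H : algType Qv) (c : W -> H)
    (x y z : W) : Qv :=
  coords c (c x * c y) z.

Definition Nint (W : groupType) (S : set W) (s0 : W) (L : W -> nat)
    (H : algType Qv) (c : W -> H) (x y z : W) : int :=
  laurent_coef (hcoef c x y z) (L (Mmax S s0 1%g))%:Z.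

Definition Rsub (W : groupType) (S : set W) (s0 : W) (L : W -> nat)
    (H : algType Qv) (c : W -> H) : set H :=
  Zspan (Qplus S s0) (cbold S s0 L c).

(** * The groups J and J_* *)

Notation Jgroup W := {freeg W / int}.

Definition tau (W : groupType) (w : W) : Jgroup W := << w >>.

(* Bilinear extension of tau_x tau_y = \sum_z N_{x,y,z} tau_z. *)
Definition Jmul (W : groupType) (N : W -> W -> W -> int) (a b : Jgroup W) :
    Jgroup W :=
  \sum_(x <- dom a) \sum_(y <- dom b)
    (\sum_(z \in [set: W]) (tau z *~ N x y z)) *~ (coeff x a * coeff y b).

Definition Jstar (W : groupType) (S : set W) (s0 : W) : set (Jgroup W) :=
  Zspan (Qplus S s0) (fun x => tau (Mmax S s0 x)).

(* Main.v *)
Require Import Defs.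
From HB Require Import structures.
From mathcomp Require Import all_boot all_order all_algebra.
From mathcomp Require Import boolp classical_sets functions cardinality fsbigop.
From mathcomp Require Import reals.
From mathcomp Require Import ring lra zify.

Set Implicit Arguments.
Unset Strict Implicit.
Unset Printing Implicit Defensive.

Import Order.TTheory GRing.Theory Num.Theory.

Local Open Scope classical_set_scope.
Local Open Scope ring_scope.

(** The products c_x c_y, for x and y maximal in their double cosets
    of W0, are integral combinations of the c_z with z maximal, up to the single
    scalar v^-N pi, where N = L(M_0) and pi is the Poincare polynomial of W0.

    If s m < m, then T_s c_m = v^L(s) c_m, and likewise on the right.  So for a
    maximal element m of a double coset, c_m is an eigenvector of every T_s with s
    in S_0, on both sides.  Right invariance makes c_m a combination of sums over
    left cosets of W0; multiplying such a sum by a left-invariant element gives a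
    factor pi.  Hence c_x c_y = v^-N pi g with g in the A-lattice, where v^-N pi is
    bar-invariant and equals v^N times a polynomial in v^-1 with constant term 1.
    The coefficients of g in the canonical basis are therefore bar-invariant
    Laurent polynomials; by the bound on products of standard basis elements they
    lie in Z[v^-1]; so they are integers, namely the coefficients of v^N in the
    structure constants.  As bold c_x is c_(M_x) divided by v^-N pi, this is (a);
    (b) and (c) follow because both families are free and the two products have
    the same structure constants.  The core is [double_max_product], which rests
    on [canonical_descent], [right_invariant_expand] and [invariant_expand].

    The eigenvector property also replaces most of the theory of Coxeter groups.
    It forces the coefficient of T_w in c_m to be v^(L(w) - L(m)) for w in the
    coset or double coset of a maximal m; as this must lie in v^-1 Z[v^-1] for w
    distinct from m, a coset has a single maximal element.  Additivity of lengths
    in cosets follows, and so does the identity L(M_0 e) = L(M_0) - L(e).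

    The geometry of the affine Weyl group supplies the rest.  Walking from alcove
    to alcove and watching the walls crossed gives the exchange condition, so that
    s w is shorter than w exactly when the wall of s separates the alcove of w
    from the base alcove.  The elements of finite conjugacy class are the
    translations; W0 fixes a vertex, so it is finite and contains no translation
    but 1.  For a translation x, the length of s x compared with that of x is
    governed by a sign, so Q+ consists of the dominant translations, and each
    double coset of W0 contains exactly one of them: existence by maximising a
    linear form over a conjugacy class, uniqueness by a length count. *)

(** * Words, generation, lengths *)

Lemma finite_argmax d (K : orderType d) (T : choiceType) (A : set T) (f : T -> K) (x0 : T) :
  finite_set A -> A x0 -> exists2 x, A x & forall y, A y -> (f y <= f x)%O.
Proof.
move=> /finite_seqP [u ->] /= x0u; have : u != [::] by case: u x0u.
elim: u {x0 x0u} => // a [_ _|b u /(_ isT) [x xu xmax] _].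
  by exists a => [|y]; rewrite /= ?inE// => /eqP ->.
have [ax|xa] := leP (f a) (f x).
  exists x => [|y]; rewrite /= inE ?xu ?orbT// => /predU1P [->//|].
  exact: xmax.
exists a => [|y]; rewrite /= inE ?eqxx// => /predU1P [->//|/xmax /le_trans].
by apply; apply: ltW.
Qed.

Section Words.
Variable W : groupType.
Implicit Types (A : set W) (u : seq W) (x y w : W).

Definition word A u : Prop := forall x, x \in u -> A x.

Definition wprod u : W := (\prod_(x <- u) x)%g.

Lemma wprod_nil : wprod [::] = 1%g.
Proof. exact: big_nil. Qed.

Lemma wprod_cons x u : wprod (x :: u) = (x * wprod u)%g.
Proof. exact: big_cons. Qed.

Lemma wprod_cat u1 u2 : wprod (u1 ++ u2) = (wprod u1 * wprod u2)%g.
Proof.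
by elim: u1 => [|x u1 IH]; rewrite ?cat0s ?wprod_nil ?mul1g// cat_cons !wprod_cons IH mulgA.
Qed.

Lemma word_nil A : word A [::].
Proof. by []. Qed.

Lemma word_cons A x u : word A (x :: u) <-> A x /\ word A u.
Proof.
split=> [Axu|[Ax Au] y]; last by rewrite inE => /predU1P [->|/Au].
by split=> [|y yu]; apply: Axu; rewrite inE ?eqxx ?yu ?orbT.
Qed.

Lemma word_cat A u1 u2 : word A (u1 ++ u2) <-> word A u1 /\ word A u2.
Proof.
split=> [Au|[A1 A2] y]; last by rewrite mem_cat => /orP [/A1|/A2].
by split=> y yu; apply: Au; rewrite mem_cat yu ?orbT.
Qed.

Lemma generated_group A : is_subgroup (generated A).
Proof.
split=> [B [[]]//|x y Ax Ay B BA|x Ax B BA].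
- by have [[_ BM _] _] := BA; apply: BM; [apply: Ax|apply: Ay].
- by have [[_ _ BV] _] := BA; apply: BV; apply: Ax.
Qed.

Lemma generated_sub A x : A x -> generated A x.
Proof. by move=> Ax B [_]; apply. Qed.

(** A monoid generated by involutions is a group, so no inverses are needed. *)
Lemma generated_ind A (P : W -> Prop) :
  (forall a, A a -> (a * a = 1)%g) -> P 1%g ->
  (forall a w, A a -> P w -> P (a * w)%g) -> forall w, generated A w -> P w.
Proof.
move=> Ainv P1 PA w Aw.
pose G := [set g | (forall w, P w -> P (g * w)%g) /\ (forall w, P w -> P (g^-1 * w)%g)].
have : G w.
  apply: Aw; split; last first.
    by move=> a Aa; split=> z Pz; rewrite ?(mulg1_eq (Ainv _ Aa)); apply: PA.
  split=> [|x y [x1 x2] [y1 y2]|x [x1 x2]].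
  - by split=> z; rewrite ?invg1 mul1g.
  - split=> z Pz; first by rewrite -mulgA; apply/x1/y1.
    by rewrite invgM -mulgA; apply/y2/x2.
  - by split=> z; rewrite ?invgK; [apply: x2|apply: x1].
by move=> [/(_ _ P1)]; rewrite mulg1.
Qed.

End Words.

Section Length.
Variables (W : groupType) (S : set W).
Hypothesis S_inv : forall s, S s -> (s * s = 1)%g.
Hypothesis S_gen : forall w, exists2 u, word S u & w = wprod u.
Local Notation len := (len S).
Implicit Types (u : seq W) (x y w s : W).

Lemma len_spec w : is_word_length S w (len w) /\
  forall j, is_word_length S w j -> (len w <= j)%N.
Proof.
have [u Su wu] := S_gen w.
have ex : exists k, `[<is_word_length S w k>].
  by exists (size u); apply/asboolP; exists u.
rewrite /Defs.len; apply: (@xgetPex _ 0%N [set k | is_word_length S w k /\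
   forall j, is_word_length S w j -> (k <= j)%N]).
case: (ex_minnP ex) => k /asboolP kw kmin; exists k; split=> // j jw.
by apply: kmin; apply/asboolP.
Qed.

Lemma len_word w : exists u, [/\ word S u, w = wprod u & size u = len w].
Proof. by have [[u [? ? ?]] _] := len_spec w; exists u. Qed.

Lemma len_le u : word S u -> (len (wprod u) <= size u)%N.
Proof. by move=> Su; have [_] := len_spec (wprod u); apply; exists u. Qed.

Lemma len1 : len 1%g = 0%N.
Proof.
have := len_le (@word_nil _ S).
rewrite wprod_nil.
rewrite leqn0. by move=> /eqP. Qed.

Lemma lenM x y : (len (x * y)%g <= len x + len y)%N.
Proof.
case: (len_word x) => u [Su xu szu]. case: (len_word y) => u2 [Su2 yu2 szu2].
rewrite -szu -szu2 {1}xu {1}yu2 -wprod_cat -size_cat; apply: len_le.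
by apply/word_cat.
Qed.

Lemma len_eq0 x : len x = 0%N -> x = 1%g.
Proof.
by have [u [_ -> <-]] := len_word x => /size0nil ->; rewrite wprod_nil.
Qed.

Lemma S_inve s : S s -> (s^-1 = s)%g.
Proof. by move=> Ss; apply: mulg1_eq; apply: S_inv. Qed.

Lemma wprod_rev u : word S u -> wprod (rev u) = ((wprod u)^-1)%g.
Proof.
elim: u => [|x u IH]; first by rewrite wprod_nil invg1.
move=> /word_cons [Sx Su].
by rewrite rev_cons -cats1 wprod_cat IH// !wprod_cons wprod_nil mulg1 invgM (S_inve Sx).
Qed.

Lemma lenV x : len (x^-1)%g = len x.
Proof.
have le y : (len (y^-1)%g <= len y)%N.
  have [u [Su yu <-]] := len_word y.
  rewrite {1}yu -wprod_rev// -(size_rev u); apply: len_le => z.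
  by rewrite mem_rev; apply: Su.
by apply/eqP; rewrite eqn_leq le/= -{1}(invgK x) le.
Qed.

Lemma len_S_le s : S s -> (len s <= 1)%N.
Proof.
move=> Ss; have := @len_le [:: s]; rewrite wprod_cons wprod_nil mulg1; apply.
by apply/word_cons.
Qed.

Lemma len_sM s x : S s -> (len (s * x)%g <= (len x).+1)%N.
Proof. by move=> /len_S_le s1; apply: leq_trans (lenM s x) _; rewrite -add1n leq_add2r. Qed.

Lemma mulSK s x : S s -> (s * (s * x) = x)%g.
Proof. by move=> Ss; rewrite mulgA S_inv// mul1g. Qed.

Lemma mulKS s x : S s -> ((x * s) * s = x)%g.
Proof. by move=> Ss; rewrite -mulgA S_inv// mulg1. Qed.

Lemma word_descent w : w <> 1%g -> exists s w', [/\ S s, w = (s * w')%g & len w = (len w').+1].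
Proof.
have [[|s u] [Su wu sz]] := len_word w; first by rewrite wu wprod_nil.
move/word_cons: Su => [Ss Su] _; exists s, (wprod u); split=> //.
  by rewrite wu wprod_cons.
apply/eqP; rewrite eqn_leq wu wprod_cons len_sM//= -wprod_cons -wu -sz /= ltnS.
exact: len_le.
Qed.

End Length.

(** * The exchange condition from walls *)

Section Exchange.
Variables (W : groupType) (S : set W).
Hypothesis S_inv : forall s, S s -> (s * s = 1)%g.
Hypothesis S_gen : forall w, exists2 u, word S u & w = wprod u.
Variable side : W -> W -> Prop.
Hypothesis side1 : forall s, S s -> side s 1%g.
Hypothesis side_switch : forall s t w, S s -> S t ->
  side s w -> ~ side s (w * t)%g -> (s * w = w * t)%g.
Hypothesis side_flip : forall s w, S s -> side s (s * w)%g <-> ~ side s w.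
Local Notation len := (len S).

(** Read side s w as: the alcove of w lies on the same side of the wall of s as
    the base alcove.  Along a word, which is a walk from the base alcove, the
    first step that crosses the wall of s is a letter that multiplication by s
    deletes. *)
Lemma exchange s u : S s -> word S u -> ~ side s (wprod u) ->
  exists u', [/\ word S u', (s * wprod u)%g = wprod u' & (size u').+1 = size u].
Proof.
move=> Ss; elim/last_ind: u => [|u t IH]; first by rewrite wprod_nil => _ /(_ (side1 Ss)).
rewrite -cats1 wprod_cat wprod_cons wprod_nil mulg1 => /word_cat [Su /word_cons [St _]] nside.
have [sideu|nsideu] := pselect (side s (wprod u)).
  exists u; split=> //; last by rewrite size_cat addn1.
  by rewrite mulgA (side_switch Ss St sideu nside) (mulKS S_inv).
have [u' [Su' e sz]] := IH Su nsideu; exists (u' ++ [:: t]); split.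
- by apply/word_cat; split=> //; apply/word_cons.
- by rewrite mulgA e wprod_cat wprod_cons wprod_nil mulg1.
- by rewrite !size_cat -sz !addn1.
Qed.

Lemma len_descent s w : S s -> ~ side s w -> len w = (len (s * w)%g).+1.
Proof.
move=> Ss ns; apply/eqP; rewrite eqn_leq; apply/andP; split.
  by have := len_sM S_gen (s * w)%g Ss; rewrite (mulSK S_inv).
have [u [Su wu <-]] := len_word S_gen w.
rewrite wu in ns *; have [u' [Su' -> <-]] := exchange Ss Su ns.
by rewrite ltnS; apply: len_le.
Qed.

Lemma len_ascent s w : S s -> side s w -> len (s * w)%g = (len w).+1.
Proof.
move=> Ss sw; have nside : ~ side s (s * w)%g by move=> /(side_flip _ Ss).
by rewrite (len_descent Ss nside) (mulSK S_inv).
Qed.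

End Exchange.

(** * Affine reflections of a Euclidean space *)

Section Dot.
Variables (R : realType) (n : nat).
Implicit Types (u w a b y : 'rV[R]_n) (k j : int).

Lemma dotC u w : dot u w = dot w u.
Proof. by apply: eq_bigr => i _; rewrite mulrC. Qed.

Lemma dotDl u w a : dot (u + w) a = dot u a + dot w a.
Proof. by rewrite -big_split; apply: eq_bigr => i _; rewrite mxE mulrDl. Qed.

Lemma dotZl (t : R) u a : dot (t *: u) a = t * dot u a.
Proof. by rewrite mulr_sumr; apply: eq_bigr => i _; rewrite mxE mulrA. Qed.

Lemma dot0l a : dot 0 a = 0.
Proof. by rewrite /dot big1// => i _; rewrite mxE mul0r. Qed.

Lemma dotNl u a : dot (- u) a = - dot u a.
Proof. by rewrite -scaleN1r dotZl mulN1r. Qed.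

Lemma dotBl u w a : dot (u - w) a = dot u a - dot w a.
Proof. by rewrite dotDl dotNl. Qed.

Lemma dotDr a u w : dot a (u + w) = dot a u + dot a w.
Proof. by rewrite !(dotC a) dotDl. Qed.

Lemma dotZr (t : R) a u : dot a (t *: u) = t * dot a u.
Proof. by rewrite !(dotC a) dotZl. Qed.

Lemma dotNr a u : dot a (- u) = - dot a u.
Proof. by rewrite !(dotC a) dotNl. Qed.

Lemma dotBr a u w : dot a (u - w) = dot a u - dot a w.
Proof. by rewrite !(dotC a) dotBl. Qed.

Lemma dot_sumr I (r : seq I) (P : pred I) (F : I -> 'rV[R]_n) a :
  dot a (\sum_(i <- r | P i) F i) = \sum_(i <- r | P i) dot a (F i).
Proof.
elim/big_rec2 : _ => [|i x y _ <-]; first by rewrite dotC dot0l.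
by rewrite dotDr.
Qed.

Lemma dot_ge0 a : 0 <= dot a a.
Proof. by apply: sumr_ge0 => i _; rewrite -expr2 sqr_ge0. Qed.

Lemma dot_eq0 a : dot a a = 0 -> a = 0.
Proof.
move=> /eqP; rewrite psumr_eq0 => [/allP/= a0|i _]; last by rewrite -expr2 sqr_ge0.
apply/rowP => i; rewrite mxE; apply/eqP.
by have := a0 i; rewrite mem_index_enum mulf_eq0 orbb; apply.
Qed.

Lemma dot_gt0 a : a != 0 -> 0 < dot a a.
Proof.
by move=> a0; rewrite lt_def dot_ge0 andbT; apply: contra_neq a0 => /dot_eq0.
Qed.

Lemma dot_coroot a : a != 0 -> dot a (coroot a) = 2.
Proof. by move=> /dot_gt0 a0; rewrite dotZr divfK// gt_eqF. Qed.

Lemma coroot_opp a : coroot (- a) = - coroot a.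
Proof. by rewrite /coroot dotNl dotNr opprK scalerN. Qed.

Lemma coroot_gt0 a b : a != 0 -> 0 < dot b a -> 0 < dot b (coroot a).
Proof. by move=> /dot_gt0 a0 ba; rewrite dotZr mulr_gt0// divr_gt0. Qed.

Lemma coroot_ge0 a b : a != 0 -> (0 <= dot b (coroot a)) = (0 <= dot b a).
Proof. by move=> /dot_gt0 a0; rewrite dotZr pmulr_rge0// divr_gt0. Qed.

(** ** Affine functions and the reflections in their zero sets *)

(** The pair (a, k) stands for the affine function taking y to (y, a) - k. *)
Definition affval (f : 'rV[R]_n * int) y : R := dot y f.1 - f.2%:~R.

Definition affrefl (f : 'rV[R]_n * int) y : 'rV[R]_n := affine_reflection f.1 f.2 y.

Lemma affreflE f y : affrefl f y = y - affval f y *: coroot f.1.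
Proof. by []. Qed.

Lemma affvalD f y z : affval f (y + z) = affval f y + dot z f.1.
Proof. by rewrite /affval dotDl addrAC. Qed.

Lemma affval_opp a k y : affval (- a, - k) y = - affval (a, k) y.
Proof. by rewrite /affval/= dotNr intrN; ring. Qed.

Lemma affrefl_opp a k y : affrefl (- a, - k) y = affrefl (a, k) y.
Proof. by rewrite !affreflE affval_opp coroot_opp scalerN scaleNr opprK. Qed.

Lemma affval_refl f y : f.1 != 0 -> affval f (affrefl f y) = - affval f y.
Proof.
move=> f0; rewrite affreflE {1}/affval dotBl dotZl (dotC (coroot _)) dot_coroot//.
by rewrite /affval; ring.
Qed.

Lemma affreflK f y : f.1 != 0 -> affrefl f (affrefl f y) = y.
Proof. by move=> f0; rewrite affreflE affval_refl// affreflE scaleNr opprK subrK. Qed.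

Lemma affrefl_sub f y z : affrefl f y - affrefl f z = affine_reflection f.1 0 (y - z).
Proof.
rewrite !affreflE /affine_reflection subr0 /affval dotBl.
by apply/rowP => i; rewrite !mxE; ring.
Qed.

Lemma dot_linrefl a y z : a != 0 ->
  dot (affine_reflection a 0 y) (affine_reflection a 0 z) = dot y z.
Proof.
move=> a0; have tN : dot a a != 0 by rewrite gt_eqF// dot_gt0.
rewrite /affine_reflection !subr0 !(dotBl, dotBr, dotZl, dotZr) (dotC y z) (dotC a z).
by field.
Qed.

Lemma coroot_linrefl a b : a != 0 ->
  coroot (affine_reflection a 0 b) = affine_reflection a 0 (coroot b).
Proof.
move=> a0; rewrite {1}/coroot dot_linrefl// /affine_reflection !subr0 dotZl.
by rewrite scalerBr scalerA.
Qed.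

End Dot.

(** * Root systems and the fundamental alcove *)

Section Roots.
Variables (R : realType) (n : nat) (Phi : set 'rV[R]_n).
Variables (delta : 'I_n -> 'rV[R]_n) (theta : 'rV[R]_n).
Hypothesis Phi_root : root_system Phi.
Hypothesis Phi_base : root_base Phi delta.
Hypothesis Phi_high : highest_root Phi delta theta.
Implicit Types (a b y : 'rV[R]_n) (i : 'I_n) (k : int).

Let D : 'M[R]_n := \matrix_(i < n) delta i.

Lemma D_unit : D \in unitmx.
Proof. by case: Phi_base. Qed.

Definition simple_coord y i : R := (y *m invmx D) 0 i.

Lemma simple_coordE y : y = \sum_i simple_coord y i *: delta i.
Proof.
rewrite -[LHS](mulmxKV D_unit) mulmx_sum_row; apply: eq_bigr => i _.
by rewrite rowK.
Qed.

Lemma simple_coord_sum (c : 'I_n -> R) i :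
  simple_coord (\sum_j c j *: delta j) i = c i.
Proof.
have -> : \sum_j c j *: delta j = (\row_j c j) *m D.
  by rewrite mulmx_sum_row; apply: eq_bigr => j _; rewrite rowK mxE.
by rewrite /simple_coord mulmxK ?D_unit// mxE.
Qed.

Lemma simple_coordD y z i : simple_coord (y + z) i = simple_coord y i + simple_coord z i.
Proof. by rewrite /simple_coord mulmxDl mxE. Qed.

Lemma simple_coordZ (t : R) y i : simple_coord (t *: y) i = t * simple_coord y i.
Proof. by rewrite /simple_coord -scalemxAl mxE. Qed.

Lemma simple_coordN y i : simple_coord (- y) i = - simple_coord y i.
Proof. by rewrite -scaleN1r simple_coordZ mulN1r. Qed.

Lemma simple_coord_delta i j : simple_coord (delta i) j = (i == j)%:R.
Proof.
rewrite -(simple_coord_sum (fun j => (i == j)%:R)); congr simple_coord.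
rewrite (bigD1 i)//= eqxx scale1r big1 ?addr0// => k /negPf.
by rewrite eq_sym => ->; rewrite scale0r.
Qed.

Lemma simple_coord_nat (m : 'I_n -> nat) i :
  simple_coord (\sum_j (delta j *+ m j)) i = (m i)%:R.
Proof.
rewrite -(simple_coord_sum (fun j => (m j)%:R)); congr simple_coord.
by apply: eq_bigr => j _; rewrite scaler_nat.
Qed.

Lemma dual_point (c : 'I_n -> R) : exists y, forall i, dot y (delta i) = c i.
Proof.
exists ((\row_j c j) *m invmx D^T) => i.
have <- : ((\row_j c j) *m invmx D^T *m D^T) 0 i = dot ((\row_j c j) *m invmx D^T) (delta i).
  by rewrite mxE; apply: eq_bigr => j _; rewrite !mxE.
by rewrite mulmxKV ?unitmx_tr ?D_unit// mxE.
Qed.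

Lemma dot_coordE y a : dot y a = \sum_i simple_coord a i * dot y (delta i).
Proof.
by rewrite {1}(simple_coordE a) dot_sumr; apply: eq_bigr => i _; rewrite dotZr.
Qed.

Lemma root_neq0 a : Phi a -> a != 0.
Proof. exact: rs_nonzero. Qed.

Lemma delta_root i : Phi (delta i).
Proof. by case: Phi_base. Qed.

Lemma theta_root : Phi theta.
Proof. by case: Phi_high. Qed.

Lemma root_refl a b : Phi a -> Phi b -> Phi (affine_reflection a 0 b).
Proof. exact: rs_reflection. Qed.

Lemma root_opp a : Phi a -> Phi (- a).
Proof.
move=> Pa; have := root_refl Pa Pa.
rewrite /affine_reflection subr0.
suff -> : a - dot a a *: coroot a = - a by [].
rewrite /coroot scalerA mulrC divfK ?gt_eqF ?dot_gt0 ?root_neq0//.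
by rewrite scaler_nat mulr2n opprD addNKr.
Qed.

Lemma root_coord_sign a : Phi a -> exists m : 'I_n -> nat,
  (forall i, simple_coord a i = (m i)%:R) \/ (forall i, simple_coord a i = - (m i)%:R).
Proof.
case: Phi_base => _ _ h /h [m [->|->]]; exists m; [left|right] => i.
  exact: simple_coord_nat.
by rewrite simple_coordN simple_coord_nat.
Qed.

Definition positive_root a := Phi a /\ forall i, 0 <= simple_coord a i.

Lemma root_sign a : Phi a -> positive_root a \/ positive_root (- a).
Proof.
move=> Pa; have [m [am|am]] := root_coord_sign Pa; [left|right]; split=> //.
- by move=> i; rewrite am ler0n.
- exact: root_opp.
- by move=> i; rewrite simple_coordN am opprK ler0n.
Qed.

Lemma positive_rootP a i : Phi a -> 0 < simple_coord a i -> positive_root a.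
Proof.
move=> Pa ai; have [//|[_ /(_ i)]] := root_sign Pa.
by rewrite simple_coordN oppr_ge0 leNgt ai.
Qed.

Lemma root_coord_neq0 a : Phi a -> exists i, simple_coord a i != 0.
Proof.
move=> Pa; apply: contrapT => /forallNP a0.
have := root_neq0 Pa; rewrite (simple_coordE a) big1 ?eqxx// => i _.
by have /negP := a0 i; rewrite negbK => /eqP ->; rewrite scale0r.
Qed.

Lemma theta_coord_ge b i : Phi b -> simple_coord b i <= simple_coord theta i.
Proof.
case: Phi_high => _ h /h [m ->].
by rewrite simple_coordD simple_coord_nat lerDl ler0n.
Qed.

Lemma theta_coord_ge1 i : 1 <= simple_coord theta i.
Proof.
by have := theta_coord_ge i (delta_root i); rewrite simple_coord_delta eqxx.
Qed.

Definition height a : R := \sum_i simple_coord a i.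

Lemma heightN a : height (- a) = - height a.
Proof. by rewrite -sumrN; apply: eq_bigr => i _; rewrite simple_coordN. Qed.

Lemma heightB a b : height (a - b) = height a - height b.
Proof.
by rewrite -heightN -big_split; apply: eq_bigr => i _; rewrite simple_coordD.
Qed.

Lemma height_gt0 a : positive_root a -> 0 < height a.
Proof.
move=> [Pa a0]; have [i ai] := root_coord_neq0 Pa.
rewrite /height (bigD1 i)//= ltr_pwDl ?sumr_ge0// lt_def ai a0//.
Qed.

Lemma height_le_theta a : Phi a -> height a <= height theta.
Proof. by move=> Pa; apply: ler_sum => i _; apply: theta_coord_ge. Qed.

Lemma height_delta i : height (delta i) = 1.
Proof.
rewrite /height (bigD1 i)//= simple_coord_delta eqxx big1 ?addr0// => j /negPf.
by rewrite simple_coord_delta eq_sym => ->.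
Qed.

(** The Coxeter number. *)
Let h : R := 1 + height theta.

Lemma height_theta_gt0 : 0 < height theta.
Proof.
apply: height_gt0; split=> [|i]; first exact: theta_root.
exact: le_trans (theta_coord_ge1 i).
Qed.

Lemma h_gt0 : 0 < h.
Proof. by rewrite addr_gt0// height_theta_gt0. Qed.

(** ** The base point of the fundamental alcove *)

(** With this choice the values of integral affine roots at the base point
    are integral multiples of 1 / h, and those of the simple ones are 1 / h. *)
Lemma base_point_ex : exists y, forall i, dot y (delta i) = h^-1.
Proof. exact: dual_point. Qed.

Definition base_point : 'rV[R]_n := projT1 (cid base_point_ex).
Local Notation p := base_point.

Lemma dot_p a : dot p a = height a / h.
Proof.
rewrite dot_coordE mulr_suml; apply: eq_bigr => i _.
by rewrite /base_point; case: cid => y /= ->.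
Qed.

Lemma dot_p_pos a : positive_root a -> 0 < dot p a < 1.
Proof.
move=> pa; rewrite dot_p divr_gt0 ?height_gt0 ?h_gt0//= ltr_pdivrMr ?h_gt0// mul1r.
by rewrite /h ltr_pwDl// height_le_theta//; case: pa.
Qed.

Definition affroot (f : 'rV[R]_n * int) := Phi f.1.

Lemma no_int01 (k : int) (x y : R) : 0 <= x -> x < k%:~R -> k%:~R < y -> y <= 1 -> False.
Proof.
move=> x0 xk ky y1; have := le_lt_trans x0 xk; have := lt_le_trans ky y1.
by rewrite ltr0z ltrz1; lia.
Qed.

Lemma affval_p_neq0 f : affroot f -> affval f p != 0.
Proof.
case: f => a k Pa; rewrite subr_eq0; apply/eqP => /= e.
have [/dot_p_pos|/dot_p_pos] := root_sign Pa; rewrite ?dotNr e -?rmorphN.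
all: by rewrite ?(ltr0z, ltrz1) => /andP [k0 k1]; lia.
Qed.

Lemma affval_p_gt0N f : affroot f -> ~ 0 < affval f p -> affval f p < 0.
Proof.
by move=> /affval_p_neq0 f0 /negP; rewrite -leNgt le_eqVlt (negPf f0).
Qed.

(** ** Walls *)

(** The simple affine roots, which are positive on the fundamental alcove. *)
Definition simple_aff (f : 'rV[R]_n * int) := (exists i, f = (delta i, 0)) \/ f = (- theta, -1).

Lemma simple_aff_root f : simple_aff f -> affroot f.
Proof.
move=> [[i ->]|->]; first exact: delta_root.
by apply: root_opp; apply: theta_root.
Qed.

Lemma simple_aff_p f : simple_aff f -> affval f p = h^-1.
Proof.
move=> [[i ->]|->]; first by rewrite /affval/= subr0 dot_p height_delta mul1r.
have := h_gt0; rewrite affval_opp /affval/= dot_p /h => h0.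
have : 1 + height theta != 0 by rewrite gt_eqF.
by move=> ?; field.
Qed.

Lemma simple_aff_p_gt0 f : simple_aff f -> 0 < affval f p.
Proof. by move=> /simple_aff_p ->; rewrite invr_gt0 h_gt0. Qed.


Lemma root_integral a b : Phi a -> Phi b -> exists m : int, dot b (coroot a) = m%:~R.
Proof. exact: rs_integral. Qed.

Lemma dot_linrefl_adj a y z :
  dot (affine_reflection a 0 y) z = dot y (affine_reflection a 0 z).
Proof.
rewrite /affine_reflection !subr0 !(dotBl, dotBr, dotZl, dotZr) (dotC a z). by ring.
Qed.

Lemma linreflZ a (t : R) y : affine_reflection a 0 (t *: y) = t *: affine_reflection a 0 y.
Proof.
rewrite /affine_reflection !subr0 dotZl; move: (coroot a) => c.
by apply/rowP => i; rewrite !mxE; ring.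
Qed.

(** This is r_(f o r_g) = r_g r_f r_g, in a form that keeps the affine root
    f o r_g abstract. *)
Lemma affrefl_transport f g : affroot f -> affroot g ->
  exists f', [/\ affroot f', forall y, affval f (affrefl g y) = affval f' y &
    forall y, affrefl g (affrefl f' y) = affrefl f (affrefl g y)].
Proof.
case: f g => a k [b j] /= Pa Pb; have [m am] := root_integral Pb Pa.
pose f' := (affine_reflection b 0 a, k - m * j).
have ff' y : affval (a, k) (affrefl (b, j) y) = affval f' y.
  rewrite affreflE /f' /affval/= /affine_reflection /coroot subr0 rmorphB rmorphM/= -am.
  by rewrite !(dotBl, dotBr, dotZl, dotZr) (dotC b a); ring.
exists f'; split=> // [|y]; first exact: root_refl.
rewrite [RHS]affreflE ff' affreflE [affrefl f' y]affreflE /= coroot_linrefl ?root_neq0//.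
have bb : dot (coroot b) b = 2 by rewrite dotC dot_coroot ?root_neq0.
rewrite affreflE /affval/= /affine_reflection; move: (coroot b) (coroot a) bb => cb ca bb.
rewrite subr0 !(dotBl, dotZl) bb.
by apply/rowP => i; rewrite !mxE; ring.
Qed.


(** A positive root other than delta_i keeps a positive coefficient on another
    simple root under the reflection, hence stays positive: only the wall of
    delta_i separates the base point from its mirror image. *)
Lemma wall_delta f i : affroot f -> 0 < affval f base_point ->
  affval f (affrefl (delta i, 0) base_point) < 0 -> f = (delta i, 0).
Proof.
case: f => a k; rewrite /affroot /= => Pa; rewrite /affval/= subr_gt0 subr_lt0 => kp.
rewrite dot_linrefl_adj => pk.
have Pb := root_refl (delta_root i) Pa; set b := affine_reflection _ _ _ in pk Pb.
have [m am] := root_integral (delta_root i) Pa.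
have bj j : simple_coord b j = simple_coord a j - m%:~R * (i == j)%:R.
  rewrite /b /affine_reflection subr0 simple_coordD simple_coordN simple_coordZ.
  by rewrite /coroot simple_coordZ simple_coord_delta -am dotZr; ring.
have [[j [ij aj]]|/forallNP ai] := pselect (exists j, i != j /\ simple_coord a j != 0).
  have bj' : simple_coord b j = simple_coord a j by rewrite bj (negPf ij) mulr0 subr0.
  have [pa|na] := root_sign Pa.
    have pb : positive_root b.
      by apply: (positive_rootP (i := j)) => //; rewrite bj' lt_def aj; case: pa => _; apply.
    have /andP [p0 _] := dot_p_pos pb; have /andP [_ p1] := dot_p_pos pa.
    by case: (no_int01 (ltW p0) pk kp (ltW p1)).
  have nb : positive_root (- b).
    apply: (positive_rootP (i := j)); first exact: root_opp.
    rewrite simple_coordN bj' -simple_coordN lt_def simple_coordN oppr_eq0 aj -simple_coordN.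
    by case: na => _; apply.
  have := dot_p_pos nb; have := dot_p_pos na; rewrite !dotNr => /andP [p0 _] /andP [_ p1].
  have p2 : - dot base_point a < (- k)%:~R by rewrite rmorphN ltrN2.
  have p3 : (- k)%:~R < - dot base_point b by rewrite rmorphN ltrN2.
  by case: (no_int01 (ltW p0) p2 p3 (ltW p1)).
have ae : a = simple_coord a i *: delta i.
  rewrite {1}(simple_coordE a) (bigD1 i)//= big1 ?addr0// => j ji.
  have [//|aj] := eqVneq (simple_coord a j) 0; first by move->; rewrite scale0r.
  by case: (ai j); rewrite eq_sym.
have bpa : dot base_point b = - dot base_point a.
  rewrite /b ae linreflZ !dotZr -mulrN; congr (_ * _); rewrite -dotNr; congr dot.
  rewrite /affine_reflection subr0 /coroot scalerA mulrC divfK ?gt_eqF ?dot_gt0 ?root_neq0//.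
    by rewrite scaler_nat mulr2n opprD addNKr.
  exact: delta_root.
have /andP [p0 p1] : 0 < dot base_point (delta i) < 1.
  apply: dot_p_pos; split=> [|j]; first exact: delta_root.
  by rewrite simple_coord_delta ler0n.
rewrite ae in Pa; have [e|e] := rs_reduced Phi_root (delta_root i) Pa.
  rewrite bpa in pk; rewrite ae e scale1r in pk kp *; congr (_, _).
  suff : (-1 < k < 1)%R by lia.
  by rewrite -(ltrz1 R) -(ltr_int R) (lt_trans kp p1) (lt_trans _ pk)// rmorphN ltrN2.
exfalso; have := lt_trans pk kp; rewrite bpa ae e scaleN1r dotNr; lra.
Qed.

(** The pairing m is nonnegative since theta is dominant.  If m were at least 2,
    the root m theta - a, which is at most theta, would force theta <= a, that is,
    a = theta. *)
Lemma theta_pairing a : positive_root a -> a <> theta ->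
  dot a (coroot theta) = 0 \/ dot a (coroot theta) = 1.
Proof.
move=> pa at_; have [Pa a0] := pa; have [m am] := root_integral theta_root Pa.
have sa : affine_reflection theta 0 a = a - m%:~R *: theta.
  rewrite /affine_reflection subr0 -am /coroot scalerA dotZr; congr (_ - _ *: _); ring.
have Pb : Phi (a - m%:~R *: theta) by rewrite -sa; apply: root_refl => //; apply: theta_root.
have th_delta i : 0 <= dot theta (coroot (delta i)).
  have Pc : Phi (affine_reflection (delta i) 0 theta).
    by apply: root_refl; [apply: delta_root|apply: theta_root].
  have := theta_coord_ge i Pc; rewrite /affine_reflection subr0 simple_coordD simple_coordN.
  rewrite /coroot !simple_coordZ simple_coord_delta eqxx mulr1 dotZr mulrA [dot _ _ * _]mulrC.
  by rewrite -mulrA; lra.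
have th_delta' i : 0 <= dot theta (delta i).
  by rewrite -coroot_ge0 ?root_neq0 ?th_delta//; apply: delta_root.
have m0 : (0 <= m)%R.
  rewrite -(ler0z R) -am coroot_ge0 ?root_neq0//; last exact: theta_root.
  by rewrite dotC dot_coordE; apply: sumr_ge0 => i _; rewrite mulr_ge0.
have m2 : ~ (2 <= m)%R.
  move=> m2; apply: at_; rewrite (simple_coordE a) (simple_coordE theta).
  apply: eq_bigr => i _; congr (_ *: _); apply/eqP; rewrite eq_le theta_coord_ge//=.
  have := theta_coord_ge i (root_opp Pb); rewrite opprB simple_coordD simple_coordN simple_coordZ.
  have : (2 : R) <= m%:~R by rewrite (ler_int R 2).
  have := theta_coord_ge1 i; move: (simple_coord a i) (simple_coord theta i) (m%:~R : R) => x y z.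
  by nra.
have : m = 0 \/ m = 1 by lia.
by rewrite am => -[->|->]; [left|right].
Qed.

(** A positive root other than theta takes values in the open interval (0, 1)
    both at the base point and at its mirror image, so none of its integral
    level sets separates the two. *)
Lemma wall_theta f : affroot f -> 0 < affval f base_point ->
  affval f (affrefl (- theta, -1) base_point) < 0 -> f = (- theta, -1).
Proof.
case: f => a k; rewrite /affroot /= => Pa; rewrite (affrefl_opp theta 1) affreflE /affval/=.
rewrite dotBl dotZl (dotC (coroot _)) subr_gt0 subr_lt0 => kp pk.
have pth : positive_root theta.
  by split=> [|i]; [apply: theta_root|apply: le_trans (theta_coord_ge1 i)].
have /andP [th0 th1] := dot_p_pos pth.
have in01 b : positive_root b -> b <> theta ->
    0 < dot base_point b - (dot base_point theta - 1) * dot b (coroot theta) < 1.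
  move=> pb bth; have /andP [p0 p1] := dot_p_pos pb.
  have [->|->] := theta_pairing pb bth; first by rewrite mulr0 subr0 p0 p1.
  have : dot base_point b < dot base_point theta; last by lra.
  rewrite !dot_p ltr_pM2r ?invr_gt0 ?h_gt0// lt_def height_le_theta ?andbT; last by case: pb.
  rewrite -subr_eq0 -heightB; apply/eqP => /eqP.
  rewrite /height psumr_eq0 => [/allP h0|i _]; last first.
    by rewrite simple_coordD simple_coordN; have := theta_coord_ge i (proj1 pb); lra.
  apply: bth; rewrite (simple_coordE b) (simple_coordE theta); apply: eq_bigr => i _.
  have := h0 i; rewrite mem_index_enum simple_coordD simple_coordN subr_eq0 => /(_ isT) /eqP <-.
  by [].
have [pa|na] := root_sign Pa.
  have [e|ath] := pselect (a = theta).
    exfalso; move: kp pk; rewrite e dot_coroot ?root_neq0//; last exact: theta_root.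
    by lra.
  have /andP [p0 _] := in01 _ pa ath; have /andP [_ p1] := dot_p_pos pa.
  by case: (no_int01 (ltW p0) pk kp (ltW p1)).
have [e|ath] := pselect (- a = theta).
  have ae : a = - theta by rewrite -e opprK.
  rewrite ae in kp pk *; congr (_, _); move: kp pk.
  rewrite !dotNl !dotNr dot_coroot ?root_neq0//; last exact: theta_root.
  move=> kp pk; suff : (-2 < k < 0)%R by lia.
  rewrite -(ltrz0 R) -(ltr_int R) (_ : (-2)%:~R = -2 :> R)//.
  by apply/andP; split; lra.
have := in01 _ na ath; have := dot_p_pos na; rewrite !dotNl !dotNr => /andP [p0 _] /andP [_ p1].
have p2 : - dot base_point a < (- k)%:~R by rewrite rmorphN ltrN2.
have p3 : (- k)%:~R < - dot base_point a - (dot base_point theta - 1) * - dot a (coroot theta).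
  by rewrite rmorphN; lra.
by case: (no_int01 (ltW p0) p2 p3 (ltW p1)).
Qed.

Lemma wall_simple f g : simple_aff g -> affroot f -> 0 < affval f base_point ->
  affval f (affrefl g base_point) < 0 -> f = g.
Proof. by move=> [[i ->]|->]; [apply: wall_delta|apply: wall_theta]. Qed.

(** The wall normals span the space and 0 is a combination of them with positive
    coefficients, so a nonzero vector cannot pair nonpositively with all. *)
Lemma exists_acute_wall a : Phi a -> exists g, simple_aff g /\ 0 < dot a g.1.
Proof.
move=> Pa; apply: contrapT => /forallNP noacute.
have da i : dot a (delta i) <= 0.
  by rewrite leNgt; apply/negP => ai; case: (noacute (delta i, 0)); split=> //; left; exists i.
have ta : 0 <= dot a theta.
  rewrite leNgt; apply/negP => at0; case: (noacute (- theta, -1)); split; first by right.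
  by rewrite dotNr oppr_gt0.
have d0 i : dot a (delta i) = 0.
  apply/eqP; rewrite eq_le da/= leNgt; apply/negP => ai.
  move: ta; rewrite dot_coordE (bigD1 i)//= leNgt => /negP; apply.
  rewrite ltr_nwDl// ?sumr_le0// => [|j _].
    by rewrite pmulr_rlt0// (lt_le_trans _ (theta_coord_ge1 i)).
  by rewrite pmulr_rle0// (lt_le_trans _ (theta_coord_ge1 j)).
have := root_neq0 Pa; rewrite (@dot_eq0 _ _ a) ?eqxx// dot_coordE big1// => i _.
by rewrite d0 mulr0.
Qed.

(** * The affine Weyl group as a group generated by reflections *)

Variables (W : groupType) (S : set W) (rho : W -> 'rV[R]_n -> 'rV[R]_n).
Hypothesis W_real : affine_weyl_realization S Phi delta theta rho.
Implicit Types (w x s t : W).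
Local Notation len := (len S).

Lemma rho1 y : rho 1%g y = y.
Proof. exact: awr_one W_real y. Qed.

Lemma rhoM x w y : rho (x * w)%g y = rho x (rho w y).
Proof. exact: awr_mul W_real x w y. Qed.

Lemma rho_ext x w : (forall y, rho x y = rho w y) -> x = w.
Proof. by move=> xw; apply: (awr_inj W_real); apply: funext. Qed.

Lemma rhoK w y : rho (w^-1)%g (rho w y) = y.
Proof. by rewrite -rhoM mulVg rho1. Qed.

Lemma refl_inv f w : affroot f -> (forall y, rho w y = affrefl f y) -> (w * w = 1)%g.
Proof.
by move=> Pf wf; apply: rho_ext => y; rewrite rhoM rho1 !wf affreflK// root_neq0.
Qed.

Lemma refl_ind (P : W -> Prop) : P 1%g ->
  (forall f g w, affroot f -> (forall y, rho g y = affrefl f y) -> P w -> P (g * w)%g) ->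
  forall w, P w.
Proof.
move=> P1 PM w; have : generated [set w | exists a (k : int), Phi a /\
  rho w = affine_reflection a k] w by rewrite (awr_gen W_real).
apply: generated_ind => // [g [a [k [Pa gk]]]|g {}w [a [k [Pa gk]]]].
  by apply: (@refl_inv (a, k)) => // y; rewrite gk.
by apply: (PM (a, k)) => // y; rewrite gk.
Qed.

Lemma affroot_transport w f : affroot f -> exists f', [/\ affroot f',
  forall y, affval f (rho w y) = affval f' y &
  forall y, rho w (affrefl f' y) = affrefl f (rho w y)].
Proof.
move: w f; apply: refl_ind => [f Pf|g r w Pg rg IH f Pf].
  by exists f; split=> // y; rewrite !rho1.
have [f1 [Pf1 v1 r1]] := affrefl_transport Pf Pg.
have [f2 [Pf2 v2 r2]] := IH _ Pf1; exists f2; split=> // y.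
  by rewrite rhoM rg v1 v2.
by rewrite !rhoM !rg r2 r1.
Qed.

Lemma affval_orbit_neq0 w f : affroot f -> affval f (rho w p) != 0.
Proof.
move=> /(affroot_transport w) [f' [Pf' v' _]].
by rewrite v' affval_p_neq0.
Qed.

Lemma affine_linear w : exists l : 'rV[R]_n -> 'rV[R]_n,
  [/\ forall y z, rho w y - rho w z = l (y - z),
      forall y z, l (y + z) = l y + l z & forall (t : R) y, l (t *: y) = t *: l y].
Proof.
move: w; apply: refl_ind => [|f g w Pf gf [l [lw lD lZ]]].
  by exists id; split=> // y z; rewrite !rho1.
exists (affine_reflection f.1 0 \o l); split=> [y z|y z|t y] /=.
- by rewrite !rhoM !gf affrefl_sub lw.
- rewrite lD /affine_reflection !subr0 dotDl; move: (coroot _) => c.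
  by apply/rowP => i; rewrite !mxE; ring.
- by rewrite lZ linreflZ.
Qed.

(** ** Simple reflections and exchange *)

Lemma S_simple s : S s <-> exists g, simple_aff g /\ forall y, rho s y = affrefl g y.
Proof.
rewrite (awr_simple W_real); split=> [[[i e]|e]|[g [[[i gi]|gt] e]]].
- by exists (delta i, 0); split=> [|y]; [left; exists i|rewrite e].
- by exists (- theta, -1); split=> [|y]; [right|rewrite (affrefl_opp theta 1) e].
- by left; exists i; apply: funext => y; rewrite e gi.
- by right; apply: funext => y; rewrite e gt (affrefl_opp theta 1).
Qed.

Definition wall s : 'rV[R]_n * int :=
  xget (0, 0) [set g | simple_aff g /\ forall y, rho s y = affrefl g y].

Lemma wallP s : S s -> simple_aff (wall s) /\ forall y, rho s y = affrefl (wall s) y.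
Proof.
by move=> /S_simple ex; apply: (@xgetPex _ _ [set g | simple_aff g /\ forall y, rho s y = affrefl g y]).
Qed.

Lemma wall_root s : S s -> affroot (wall s).
Proof. by move=> /wallP [/simple_aff_root]. Qed.

Lemma simple_inv s : S s -> (s * s = 1)%g.
Proof. by move=> /wallP [/simple_aff_root /refl_inv]; apply. Qed.

(** Every reflection is a product of simple ones: conjugating by a simple
    reflection lowers the value at the base point of the affine root. *)
Lemma refl_word N f : affroot f -> 0 < affval f p ->
  (1 + height theta) * affval f p <= N%:R ->
  exists2 u, word S u & forall y, rho (wprod u) y = affrefl f y.
Proof.
elim: N f => [|N IH] f Pf f0 fN.
  by move: fN; rewrite leNgt mulr_gt0// h_gt0.
have [g [sg ag]] := exists_acute_wall Pf.
have [s Ss sE] : exists2 s, S s & forall y, rho s y = affrefl g y.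
  have [s se] := awr_refl W_real g.2 (simple_aff_root sg).
  by exists s => [|y]; [apply/S_simple; exists g; split=> // y|]; rewrite se.
have Pg := simple_aff_root sg.
have [f' [Pf' v' r']] := affrefl_transport Pf Pg.
have [fs|fs] := ltP (affval f (affrefl g p)) 0.
  exists [:: s]; first exact/word_cons.
  by move=> y; rewrite wprod_cons wprod_nil mulg1 sE (wall_simple sg Pf f0 fs).
have f'0 : 0 < affval f' p by rewrite lt_def affval_p_neq0// -v'.
have [|u Su ur] := IH f' Pf' f'0.
  have [m gm] := root_integral Pg Pf.
  have m1 : (1 : R) <= m%:~R.
    by have := coroot_gt0 (root_neq0 Pg) ag; rewrite gm ltr0z (ler_int R 1).
  have -> : affval f' p = affval f p - (1 + height theta)^-1 * m%:~R.
    by rewrite -v' affreflE affvalD dotNl dotZl (simple_aff_p sg) (dotC (coroot _)) gm.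
  by rewrite mulrBr mulrA divff ?gt_eqF ?h_gt0// mul1r; move: fN; rewrite -natr1; lra.
exists (s :: u ++ [:: s]).
  by apply/word_cons; split=> //; apply/word_cat; split=> //; apply/word_cons.
move=> y; rewrite wprod_cons wprod_cat wprod_cons wprod_nil mulg1 !rhoM ur !sE r'.
by rewrite affreflK// root_neq0.
Qed.

Lemma simple_gen w : exists2 u, word S u & w = wprod u.
Proof.
move: w; apply: refl_ind => [|f g w Pf gf [u Su ->]].
  by exists [::]; rewrite ?wprod_nil.
wlog f0 : f Pf gf / 0 < affval f p.
  move=> wl; have [|nf0] := pselect (0 < affval f p); first exact: wl.
  have := affval_p_gt0N Pf nf0; case: f Pf gf {nf0} => a k Pa gf; rewrite -oppr_gt0 -affval_opp.
  by apply: wl => // [|y]; [apply: root_opp|rewrite affrefl_opp].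
have [N fN] : exists N : nat, (1 + height theta) * affval f p <= N%:R.
  exists (Num.bound ((1 + height theta) * affval f p)); apply: ltW.
  by rewrite archi_boundP// mulr_ge0 ?ltW ?h_gt0.
have [u' Su' ur] := refl_word Pf f0 fN; exists (u' ++ u); first exact/word_cat.
by rewrite wprod_cat; congr (_ * _)%g; apply: rho_ext => y; rewrite ur gf.
Qed.

Definition wall_side s w := 0 < affval (wall s) (rho w p).

Lemma wall_side1 s : S s -> wall_side s 1%g.
Proof. by move=> Ss; rewrite /wall_side rho1 simple_aff_p_gt0//; case: (wallP Ss). Qed.

Lemma wall_sideN s w : S s -> ~ wall_side s w -> affval (wall s) (rho w p) < 0.
Proof.
move=> /wall_root /(affval_orbit_neq0 w) s0 /negP.
by rewrite -leNgt le_eqVlt (negPf s0).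
Qed.

(** If the step from w to w t crosses the wall of s, then this wall is the
    common wall of the alcoves of w and w t, so w conjugates t to s. *)
Lemma wall_side_switch s t w : S s -> S t ->
  wall_side s w -> ~ wall_side s (w * t)%g -> (s * w = w * t)%g.
Proof.
move=> Ss St sw /(wall_sideN Ss) swt.
have [_ ts] := wallP St; have [_ ss] := wallP Ss.
have [f [Pf v r]] := affroot_transport w (wall_root Ss).
have e : f = wall t.
  apply: (wall_simple (proj1 (wallP St)) Pf).
  - by rewrite -v.
  - by rewrite -ts -v -rhoM.
by apply: rho_ext => y; rewrite !rhoM ts -e r ss.
Qed.

Lemma wall_side_flip s w : S s -> wall_side s (s * w)%g <-> ~ wall_side s w.
Proof.
move=> Ss; have [/simple_aff_root Pf ss] := wallP Ss.
rewrite /wall_side rhoM ss affval_refl ?root_neq0// oppr_gt0; split=> [? ?|]; first by lra.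
exact: wall_sideN.
Qed.

Lemma affine_len_descent s w : S s -> ~ wall_side s w -> len w = (len (s * w)%g).+1.
Proof.
exact: (@len_descent W S simple_inv simple_gen wall_side wall_side1 wall_side_switch s w).
Qed.

Lemma affine_len_ascent s w : S s -> wall_side s w -> len (s * w)%g = (len w).+1.
Proof.
exact: (@len_ascent W S simple_inv simple_gen wall_side wall_side1 wall_side_switch wall_side_flip s w).
Qed.

(** ** Translations *)

Lemma root_translation a : Phi a ->
  exists t, forall (k : nat) y, rho (t ^+ k)%g y = y + k%:R *: coroot a.
Proof.
move=> Pa; have [t1 e1] := awr_refl W_real 1 Pa; have [t0 e0] := awr_refl W_real 0 Pa.
have tE y : rho (t1 * t0)%g y = y + coroot a.
  rewrite rhoM e1 e0 /affine_reflection dotBl dotZl subr0 (dotC (coroot a)).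
  rewrite dot_coroot ?root_neq0//; move: (coroot a) => c.
  by apply/rowP => i; rewrite !mxE; ring.
exists (t1 * t0)%g; elim=> [|k IH] y; first by rewrite expg0 rho1 scale0r addr0.
rewrite expgS rhoM IH tE; move: (coroot a) => c.
by apply/rowP => i; rewrite !mxE -natr1; ring.
Qed.

(** If the linear part l of x moved a coroot d, conjugating x by the multiples
    of the translation by d would give infinitely many conjugates.  So l fixes
    all coroots, and these span. *)
Lemma translation_vector x : translations x -> exists l, forall y, rho x y = y + l.
Proof.
move=> xfin; have [l [lw lD lZ]] := affine_linear x.
have lN y : l (- y) = - l y by rewrite -scaleN1r lZ scaleN1r.
have lroot a : Phi a -> l a = a.
  move=> Pa; have [t tE] := root_translation Pa.
  have lc : l (coroot a) = coroot a.
    apply: contrapT => /eqP; rewrite -subr_eq0 => d0; apply: infinite_nat.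
    pose f (k : nat) := ((t ^+ k)^-1 * x * t ^+ k)%g.
    have -> : [set: nat] = f @^-1` [set (g^-1 * x * g)%g | g in [set: W]].
      by apply/seteqP; split=> // k _ /=; exists (t ^+ k)%g.
    apply: finite_preimage xfin => k j _ _ /(congr1 (fun w => rho w 0)).
    have fE (i : nat) : rho (f i) 0 = rho x 0 + i%:R *: (l (coroot a) - coroot a).
      rewrite /f !rhoM tE add0r; set z := rho x _.
      have zE : z = rho x 0 + i%:R *: l (coroot a).
        by rewrite -[LHS](subrK (rho x 0)) lw subr0 lZ addrC.
      by rewrite -{1}(subrK (i%:R *: coroot a) z) -tE rhoK zE scalerBr addrA.
    rewrite !fE => /addrI /eqP; rewrite -subr_eq0 -scalerBl scaler_eq0 (negPf d0) orbF.
    by rewrite subr_eq0 => /eqP /mulrIn; apply; rewrite oner_eq0.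
  have ac : a = (dot a a / 2) *: coroot a.
    rewrite /coroot scalerA (_ : _ * _ = 1) ?scale1r//.
    by have := dot_gt0 (root_neq0 Pa) => a0; field; rewrite gt_eqF.
  by rewrite {1}ac lZ lc -ac.
exists (rho x 0) => y; rewrite -[LHS](subrK (rho x 0)) lw subr0; congr (_ + _).
rewrite (simple_coordE y).
have l0 : l 0 = 0 by have := lZ 0 0; rewrite !scale0r.
elim/big_rec: _ => [//|i z _ IH].
by rewrite lD lZ IH lroot//; apply: delta_root.
Qed.

Lemma translation_comm x f s : (forall y, rho s y = affrefl f y) ->
  forall l, (forall y, rho x y = y + l) -> dot l f.1 = 0 -> (x * s = s * x)%g.
Proof.
move=> sf l xl l0; apply: rho_ext => y; rewrite !rhoM !sf !xl !affreflE affvalD l0 addr0.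
by rewrite addrAC.
Qed.

(** The integer m by which x raises the affine function of the wall of s is
    nonnegative because s x is longer than x.  If m = 0, then x preserves the
    wall, and if m > 0, then x^-1 moves the base alcove across it. *)
Lemma translation_ascent x s : translations x -> S s -> len (s * x)%g = (len x).+1 ->
  (len (x * s)%g < len x)%N \/ (x * s = s * x)%g.
Proof.
move=> /translation_vector [l xl] Ss sx; have [sg sr] := wallP Ss.
have side_sx : wall_side s x.
  by apply: contrapT => /(affine_len_descent Ss); rewrite sx; lia.
have [m lm] : exists m : int, dot l (wall s).1 = m%:~R.
  have [f [_ v _]] := affroot_transport x (wall_root Ss).
  exists ((wall s).2 - f.2); move: (v 0); rewrite xl affvalD /affval !dot0l rmorphB; lra.
have p1 : affval (wall s) p < 1.
  by rewrite simple_aff_p// invf_lt1 ?h_gt0// ltrDl height_theta_gt0.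
have m0 : (0 <= m)%R.
  move: side_sx; rewrite /wall_side xl affvalD lm => ?.
  suff : (-1)%:~R < (m%:~R : R) by rewrite ltr_int; lia.
  by rewrite rmorphN; lra.
have [m_eq0|m_neq0] := eqVneq m 0.
  by right; apply: (translation_comm sr xl); rewrite lm m_eq0.
left; have m1 : (1 : R) <= m%:~R by rewrite (ler_int R 1); lia.
have xVl y : rho (x^-1)%g y = y - l by rewrite -{1}(subrK l y) -xl rhoK.
have nside : ~ wall_side s (x^-1)%g by rewrite /wall_side xVl affvalD dotNl lm; lra.
have := affine_len_descent Ss nside.
have inv_s : (s^-1 = s)%g by apply: mulg1_eq; apply: simple_inv.
rewrite (lenV simple_inv simple_gen) => ->.
by rewrite -{2}inv_s -invgM (lenV simple_inv simple_gen).
Qed.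

(** ** The stabiliser of a vertex of the alcove *)

Variable s0 : W.
Hypothesis S_s0 : S s0.
Local Notation W0 := (parabolic0 S s0).

(** The walls other than that of s0 meet in a vertex of the alcove: the origin
    if s0 is the affine reflection, and otherwise the point on the highest wall
    where all simple roots but one vanish. *)
Lemma vertex_ex : exists q, forall s, (S `\ s0) s -> rho s q = q.
Proof.
have fixq q s : S s -> affval (wall s) q = 0 -> rho s q = q.
  by move=> /wallP [_ ->]; rewrite affreflE => ->; rewrite scale0r subr0.
have s_eq s : S s -> wall s = wall s0 -> s = s0.
  move=> Ss e; apply: rho_ext => y.
  by have [_ ->] := wallP Ss; have [_ ->] := wallP S_s0; rewrite e.
have [[[i i0]|t0] _] := wallP S_s0.
  have [q qd] := dual_point (fun j => if j == i then (simple_coord theta i)^-1 else 0).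
  exists q => s [Ss ss0]; apply: fixq => //; have [[[j sj]|st] _] := wallP Ss.
    rewrite sj /affval/= subr0 qd; case: eqP => // ji; case: ss0.
    by apply: s_eq; rewrite // sj ji.
  rewrite st affval_opp /affval/= dot_coordE (bigD1 i)//= qd eqxx big1 ?addr0.
    by rewrite divff ?subrr ?oppr0// gt_eqF// (lt_le_trans _ (theta_coord_ge1 i)).
  by move=> j /negPf ji; rewrite qd ji mulr0.
exists 0 => s [Ss ss0]; apply: fixq => //; have [[[j sj]|st] _] := wallP Ss.
  by rewrite sj /affval/= dot0l subr0.
by case: ss0; apply: s_eq; rewrite // st.
Qed.

Definition vertex := projT1 (cid vertex_ex).
Local Notation q := vertex.

Lemma vertex_S0 s : (S `\ s0) s -> rho s q = q.
Proof. by rewrite /vertex; case: cid => /= z; apply. Qed.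

Lemma S0_inv s : (S `\ s0) s -> (s * s = 1)%g.
Proof. by move=> [Ss _]; apply: simple_inv. Qed.

Lemma vertex_fixed w : W0 w -> rho w q = q.
Proof.
move: w; apply: generated_ind => [s|//|s w Ss IH]; first exact: S0_inv.
  exact: rho1.
by rewrite rhoM IH vertex_S0.
Qed.

Lemma vertex_roots w a : W0 w -> Phi a -> Phi (rho w (q + a) - q).
Proof.
move=> Ww; move: w Ww a; apply: generated_ind => [s|a|s w S0s IH a Pa]; first exact: S0_inv.
  by rewrite rho1 addrC addKr.
have [Ss _] := S0s; have [_ sE] := wallP Ss.
rewrite rhoM -{2}(vertex_S0 S0s) !sE affrefl_sub.
by apply: root_refl; [apply: wall_root|apply: IH].
Qed.

(** The elements of W0 fix a vertex, hence are determined by the permutation of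
    the finite spanning set of roots that they induce around it. *)
Lemma parabolic_finite : finite_set W0.
Proof.
have /finite_seqP [P PE] := rs_finite Phi_root.
pose F w : {ffun seq_sub P -> seq_sub P} := [ffun a => insubd a (rho w (q + val a) - q)].
pose G phi : W := xget 1%g [set w | W0 w /\ F w = phi].
apply: (sub_finite_set _ (finite_image G (@finite_finset _ setT))) => w Ww.
exists (F w) => //; rewrite /G; move: (xget _ _) (@xgetPex _ 1%g [set x | W0 x /\ F x = F w]
  (ex_intro _ w (conj Ww erefl))) => x [Wx xw].
have [l [lx lD lZ]] := affine_linear x; have [m [mw mD mZ]] := affine_linear w.
have lm a : Phi a -> l a = m a.
  move=> Pa; have aP : a \in P by move: Pa; rewrite PE.
  move/ffunP/(_ (SeqSub aP))/(congr1 val): xw; rewrite !ffunE !val_insubd /=.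
  have /[!PE]/= -> := vertex_roots Wx Pa; have /[!PE]/= -> := vertex_roots Ww Pa.
  move=> e; have : rho x (q + a) - rho x q = rho w (q + a) - rho w q.
    by rewrite (vertex_fixed Wx) (vertex_fixed Ww).
  by rewrite lx mw addrC addKr.
have xy y z : rho x y - rho x z = rho w y - rho w z.
  rewrite lx mw (simple_coordE (y - z)).
  have l0 : l 0 = 0 by have := lZ 0 0; rewrite !scale0r.
  have m0 : m 0 = 0 by have := mZ 0 0; rewrite !scale0r.
  elim/big_rec: _ => [|i u _ IH]; first by rewrite l0 m0.
  by rewrite lD mD lZ mZ IH lm//; apply: delta_root.
apply: rho_ext => y; have := xy y q; rewrite (vertex_fixed Wx) (vertex_fixed Ww).
by move/addIr.
Qed.

Lemma parabolic_translation w : W0 w -> translations w -> w = 1%g.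
Proof.
move=> /vertex_fixed wq /translation_vector [l wl]; apply: rho_ext => y.
move: wq; rewrite rho1 !wl => /eqP; rewrite -subr_eq0 addrAC subrr add0r => /eqP ->.
by rewrite addr0.
Qed.

(** A conjugate of x whose translation vector pairs maximally with the
    direction from the vertex into the alcove is dominant. *)
Lemma dominant_conj x : translations x ->
  (forall u, translations (u * x * u^-1)%g) ->
  exists2 u, W0 u & Qplus S s0 (u * x * u^-1)%g.
Proof.
move=> Qx Qc; pose f u := dot (rho (u * x * u^-1)%g 0) (p - q).
have [W1 WM _] := generated_group (S `\ s0).
have [u Wu umax] := finite_argmax f parabolic_finite W1.
exists u => //; split=> // s S0s; have [Ss _] := S0s; have [sg sE] := wallP Ss.
apply: (affine_len_ascent Ss); have [l xl] := translation_vector (Qc u).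
rewrite /wall_side xl affvalD ltr_pwDl ?simple_aff_p_gt0//.
have := umax _ (WM _ _ (generated_sub S0s) Wu); rewrite /f !xl add0r.
have inv_s : (s^-1 = s)%g by apply: mulg1_eq; apply: simple_inv.
rewrite invgM inv_s !mulgA -(mulgA _ u) -(mulgA s) -[(u * x * _)%g]/(u * x * u^-1)%g.
have bn0 : (wall s).1 != 0 by apply/root_neq0/(simple_aff_root sg).
have -> : rho (s * (u * x * u^-1) * s)%g 0 = affine_reflection (wall s).1 0 l.
  rewrite (rhoM (s * _)%g) (rhoM s) xl !sE -[LHS]subr0 -[X in _ - X](affreflK 0 bn0).
  by rewrite affrefl_sub addrC addKr.
have vb : 0 < dot (p - q) (wall s).1.
  have qs : affval (wall s) q = 0.
    apply/eqP; have := vertex_S0 S0s; rewrite sE affreflE => /eqP.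
    rewrite -subr_eq0 addrAC subrr add0r oppr_eq0 scaler_eq0 => /orP [//|/eqP c0].
    by have := dot_coroot bn0; rewrite c0 dotC dot0l => /eqP; rewrite eq_sym pnatr_eq0.
  have := simple_aff_p_gt0 sg; move: qs; rewrite /affval dotBl; lra.
have cb : 0 < dot (coroot (wall s).1) (p - q) by rewrite dotC coroot_gt0.
rewrite /affine_reflection subr0 dotBl dotZl gerBl.
by rewrite pmulr_lge0.
Qed.

End Roots.

(** * Translations, and a summary of the geometry *)

Section Translations.
Variable W : groupType.
Implicit Types x y u w : W.

Lemma translations1 : translations (1%g : W).
Proof.
apply: (sub_finite_set _ (finite_set1 1%g)) => _ [g _ <-] /=.
by rewrite mulg1 mulVg.
Qed.

Lemma translationsM x y : translations x -> translations y -> translations (x * y)%g.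
Proof.
move=> Qx Qy; apply: (sub_finite_set _ (finite_image2 (fun a b => (a * b)%g) Qx Qy)).
move=> _ [g _ <-]; exists (g^-1 * x * g)%g; first by exists g.
exists (g^-1 * y * g)%g; first by exists g.
by rewrite !mulgA mulgK.
Qed.

Lemma translationsV x : translations x -> translations (x^-1)%g.
Proof.
move=> Qx; apply: (sub_finite_set _ (finite_image (fun a => a^-1)%g Qx)) => _ [g _ <-].
by exists (g^-1 * x * g)%g; [exists g|rewrite !invgM invgK mulgA].
Qed.

Lemma translationsJ x u : translations x -> translations (u * x * u^-1)%g.
Proof.
move=> Qx; apply: (sub_finite_set _ Qx) => _ [g _ <-]; exists (u^-1 * g)%g => //.
by rewrite invgM invgK !mulgA.
Qed.

End Translations.

(** The interface between the geometry and the Hecke algebra: the arguments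
    about the latter use nothing else about W. *)
Record special_data (W : groupType) (S : set W) (s0 : W) : Prop := {
  sd_inv : forall s, S s -> (s * s = 1)%g;
  sd_gen : forall w, exists2 u, word S u & w = wprod u;
  sd_len : forall s w, S s ->
    len S (s * w)%g = (len S w).+1 \/ len S w = (len S (s * w)%g).+1;
  sd_finite : finite_set (parabolic0 S s0);
  sd_disjoint : forall w, parabolic0 S s0 w -> translations w -> w = 1%g;
  sd_product : forall w, exists x u,
    [/\ translations x, parabolic0 S s0 u & w = (x * u)%g];
  sd_ascent : forall x s, translations x -> S s -> len S (s * x)%g = (len S x).+1 ->
    (len S (x * s)%g < len S x)%N \/ (x * s = s * x)%g;
  sd_dominant : forall x, translations x ->
    exists2 u, parabolic0 S s0 u & Qplus S s0 (u * x * u^-1)%g }.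

(** The products x u form a subgroup because the translations are normal, and
    specialness says that the factors generate the whole group. *)
Lemma special_product (W : groupType) (S : set W) (s0 : W) : special S s0 ->
  forall w, exists x u, [/\ translations x, parabolic0 S s0 u & w = (x * u)%g].
Proof.
move=> [_ gen] w; pose G : set W :=
  [set w | exists x u, [/\ translations x, parabolic0 S s0 u & w = (x * u)%g]].
have [W1 WM WV] := generated_group (S `\ s0).
have Gg : is_subgroup G.
  split.
  - by exists 1%g, 1%g; rewrite mulg1; split=> //; apply: translations1.
  - move=> _ _ [x [u [Qx Wu ->]]] [x' [u' [Qx' Wu' ->]]].
    exists (x * (u * x' * u^-1))%g, (u * u')%g; split; last by rewrite !mulgA mulgVK.
      by apply: translationsM => //; apply: translationsJ.
    exact: WM.
  - move=> _ [x [u [Qx Wu ->]]].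
    exists (u^-1 * x^-1 * u^-1^-1)%g, (u^-1)%g; split; last by rewrite mulgVK invgM.
      by apply/translationsJ/translationsV.
    exact: WV.
have : generated (@translations W `|` parabolic0 S s0) w by rewrite gen.
apply: (smallest_sub Gg) => z [Qz|Wz].
  by exists z, 1%g; rewrite mulg1.
by exists 1%g, z; rewrite mul1g; split=> //; apply: translations1.
Qed.

Lemma affine_special_data (R : realType) (W : groupType) (S : set W) (s0 : W) :
  irreducible_affine_weyl_group R S -> special S s0 -> special_data S s0.
Proof.
move=> [n [Phi [delta [theta [rho [[Phir _ _] base high real]]]]]] sp; have [S_s0 _] := sp.
split.
- by move=> s Ss; eapply simple_inv; eassumption.
- by move=> w; eapply simple_gen; eassumption.
- move=> s w Ss; have [side|nside] := pselect (wall_side theta base rho s w).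
    by left; eapply affine_len_ascent; eassumption.
  by right; eapply affine_len_descent; eassumption.
- by eapply parabolic_finite; eassumption.
- by move=> w Ww Qw; eapply parabolic_translation; eassumption.
- exact: special_product.
- by move=> x s Qx Ss sx; eapply translation_ascent; eassumption.
- move=> x Qx; eapply dominant_conj; try eassumption.
  by move=> u; apply: translationsJ.
Qed.

(** * Finitely supported sums and integral spans *)

Section Spans.
Variables (I : choiceType) (V : zmodType) (D : set I).
Implicit Types (a b : I -> int) (e : I -> V) (u : seq I).

Lemma finsupp_seq (M : nmodType) (a : I -> M) : finsupp_on D a ->
  exists2 u, uniq u & forall i, (i \in u) <-> D i /\ a i != 0.
Proof.
move=> /finite_seqP [u uE]; exists (undup u); first exact: undup_uniq.
move=> i; rewrite mem_undup; have -> : (i \in u) = [set` u] i :> Prop by [].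
by rewrite -uE.
Qed.

Lemma fsum_seq (F : I -> V) u : uniq u -> (forall i, i \in u -> D i) ->
  (forall i, D i -> i \notin u -> F i = 0) -> \sum_(i \in D) F i = \sum_(i <- u) F i.
Proof.
move=> uu uD uF; rewrite (fsbigE u)// big_seq_cond [RHS]big_seq.
by apply: eq_bigl => i; have [/uD/mem_set ->|] := boolP (i \in u).
Qed.

Lemma fsum_ind (K : V -> Prop) (F : I -> V) : K 0 ->
  (forall x y, K x -> K y -> K (x + y)) -> (forall i, D i -> K (F i)) ->
  K (\sum_(i \in D) F i).
Proof.
move=> K0 KD KF; rewrite big_seq; elim/big_rec: _ => // i x.
case: finite_supportP => //= X XD _ _ iX Kx; apply: KD => //.
by apply: KF; apply: XD.
Qed.

(** A common finite support, on which two finitely supported sums can be compared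
    term by term. *)
Lemma finsupp_pair (M N : nmodType) (a : I -> M) (b : I -> N) :
  finsupp_on D a -> finsupp_on D b ->
  exists u, [/\ uniq u, forall i, i \in u -> D i,
    forall i, D i -> i \notin u -> a i = 0 & forall i, D i -> i \notin u -> b i = 0].
Proof.
move=> /finsupp_seq [u uu uE] /finsupp_seq [u' uu' uE'].
exists (undup (u ++ u')); split=> [|i|i Di|i Di]; rewrite ?undup_uniq//.
- by rewrite mem_undup mem_cat => /orP [/uE []|/uE' []].
- rewrite mem_undup mem_cat => /norP [iu _]; apply/eqP; apply: contraNT iu => ai.
  by apply/uE.
- rewrite mem_undup mem_cat => /norP [_ iu]; apply/eqP; apply: contraNT iu => ai.
  by apply/uE'.
Qed.

Lemma finsuppP (M : nmodType) (a : I -> M) u :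
  (forall i, D i -> i \notin u -> a i = 0) -> finsupp_on D a.
Proof.
move=> h; apply: (sub_finite_set _ (finite_seq u)) => i [Di /= ai].
by apply: contraNT ai => iu; rewrite h.
Qed.

Lemma finsupp_mapzB a b : finsupp_on D a -> finsupp_on D b ->
  finsupp_on D (fun i => a i - b i).
Proof.
move=> fa fb; have [u [_ _ au bu]] := finsupp_pair fa fb.
by apply: (@finsuppP _ _ u) => i Di iu; rewrite au// bu// subr0.
Qed.

Lemma fsum_mulzB e a b : finsupp_on D a -> finsupp_on D b ->
  \sum_(i \in D) (e i *~ (a i - b i)) =
  \sum_(i \in D) (e i *~ a i) - \sum_(i \in D) (e i *~ b i).
Proof.
move=> fa fb; have [u [uu uD au bu]] := finsupp_pair fa fb.
rewrite !(@fsum_seq _ u)// => [|i Di iu|i Di iu|i Di iu]; rewrite ?au ?bu ?subr0//.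
by rewrite -sumrB; apply: eq_bigr => i _; rewrite mulrzBr.
Qed.

Lemma finsupp_delta (M : nmodType) (j : I) (k : M) :
  finsupp_on D (fun i => if i == j then k else 0).
Proof.
by apply: (@finsuppP _ _ [:: j]) => i _; rewrite inE => /negPf ->.
Qed.

Lemma fsum_delta (F : I -> V) j : D j -> (forall i, i != j -> F i = 0) ->
  \sum_(i \in D) F i = F j.
Proof.
move=> Dj Fj; rewrite (@fsum_seq _ [:: j])// => [|i|i _]; first by rewrite big_seq1.
  by rewrite inE => /eqP ->.
by rewrite inE => /Fj.
Qed.

Lemma ZspanB e x y : Zspan D e x -> Zspan D e y -> Zspan D e (x - y).
Proof.
move=> [a fa ->] [b fb ->]; exists (fun i => a i - b i); first exact: finsupp_mapzB.
by rewrite fsum_mulzB.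
Qed.

Lemma Zspan0 e : Zspan D e 0.
Proof.
exists (fun=> 0); first by apply: (@finsuppP _ _ [::]).
by rewrite fsbig1.
Qed.

Lemma ZspanN e x : Zspan D e x -> Zspan D e (- x).
Proof. by rewrite -sub0r; apply: ZspanB; apply: Zspan0. Qed.

Lemma ZspanD e x y : Zspan D e x -> Zspan D e y -> Zspan D e (x + y).
Proof. by move=> xD yD; rewrite -[y]opprK; apply/ZspanB/ZspanN. Qed.

Lemma Zspan_mulz e i k : D i -> Zspan D e (e i *~ k).
Proof.
move=> Di; exists (fun j => if j == i then k else 0); first exact: finsupp_delta.
by rewrite (@fsum_delta _ i)// ?eqxx// => j /negPf ->.
Qed.

Lemma Zspan_gen e i : D i -> Zspan D e (e i).
Proof. by move=> Di; rewrite -[e i]mulr1z; apply: Zspan_mulz. Qed.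

Lemma Zspan_min e (K : V -> Prop) : K 0 -> (forall x y, K x -> K y -> K (x - y)) ->
  (forall i, D i -> K (e i)) -> forall x, Zspan D e x -> K x.
Proof.
move=> K0 KB Ke x [a _ ->].
have KN y : K y -> K (- y) by rewrite -sub0r; apply: KB.
have KD y z : K y -> K z -> K (y + z) by move=> Ky Kz; rewrite -[z]opprK; apply/KB/KN.
apply: fsum_ind => // i /Ke Ki; have Kn m : K (e i *+ m) by elim: m => // m IH; rewrite mulrS; apply: KD.
case: (a i) => m; first exact: Kn.
by rewrite NegzE mulrNz; apply/KN/Kn.
Qed.

Lemma Zfree_inj e a b : Zfree D e -> finsupp_on D a -> finsupp_on D b ->
  \sum_(i \in D) (e i *~ a i) = \sum_(i \in D) (e i *~ b i) ->
  forall i, D i -> a i = b i.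
Proof.
move=> free fa fb ab i Di; apply/eqP; rewrite -subr_eq0; apply/eqP.
apply: (free (fun i => a i - b i)) => //; first exact: finsupp_mapzB.
by rewrite fsum_mulzB// ab subrr.
Qed.

End Spans.

(** * Laurent polynomials *)

Definition evz (x : Qv) (P : {poly int}) : Qv := (map_poly intr P).[x].

Lemma evzC x c : evz x c%:P = c%:~R.
Proof. by rewrite /evz map_polyC/= hornerC. Qed.

Lemma evzX x : evz x 'X = x.
Proof. by rewrite /evz map_polyX hornerX. Qed.

Lemma evzM x P Q : evz x (P * Q) = evz x P * evz x Q.
Proof. by rewrite /evz rmorphM/= hornerM. Qed.

Lemma evzD x P Q : evz x (P + Q) = evz x P + evz x Q.
Proof. by rewrite /evz rmorphD/= hornerD. Qed.

Lemma evzB x P Q : evz x (P - Q) = evz x P - evz x Q.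
Proof. by rewrite /evz rmorphB/= hornerD hornerN. Qed.

Lemma evzXn x n : evz x 'X^n = x ^+ n.
Proof. by elim: n => [|n IH]; rewrite ?expr0 ?exprS ?evzM ?IH ?evzX// (evzC x 1). Qed.

Lemma evz_v P : evz v P = tofrac (map_poly intr P).
Proof.
elim/poly_ind: P => [|P c IH]; first by rewrite (evzC v 0) !rmorph0.
rewrite evzD evzM evzX evzC IH !rmorphD !rmorphM/= map_polyX map_polyC/=.
by rewrite rmorph_int rmorph_int.
Qed.

Lemma evz_v_inj P : evz v P = 0 -> P = 0.
Proof.
rewrite evz_v => /eqP; rewrite tofrac_eq0 => /eqP P0; apply/polyP => i.
have := congr1 (fun Q : {poly rat} => Q`_i) P0.
by rewrite coef_map/= !coef0 => /eqP; rewrite intr_eq0 => /eqP.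
Qed.

Lemma v_neq0 : v != 0.
Proof. by rewrite /v tofrac_eq0 polyX_eq0. Qed.

Lemma v_unit : v \is a GRing.unit.
Proof. by rewrite unitfE v_neq0. Qed.

Lemma evz_poly x n (E : nat -> int) :
  evz x (\poly_(i < n) E i) = \sum_(i < n) (E i)%:~R * x ^+ i.
Proof.
rewrite poly_def /evz rmorph_sum/= horner_sum; apply: eq_bigr => i _.
by rewrite -mul_polyC rmorphM/= map_polyC/= map_polyXn hornerM hornerC hornerXn.
Qed.

Lemma evz_sum x P : evz x P = \sum_(i < size P) (P`_i)%:~R * x ^+ i.
Proof. by rewrite -{1}[P]coefK evz_poly. Qed.

(** Multiplying by a large power of v turns a relation into a vanishing
    polynomial in the indeterminate v. *)
Lemma vpow_free : Zfree [set: int] (fun n : int => v ^ n).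
Proof.
move=> a fa a0 n0 _; have [u uu uE] := finsupp_seq fa.
pose M := (\max_(n <- u) `|n|%N)%N.
have uM n : a n != 0 -> (`|n| <= M)%N.
  by move=> an; have nu : n \in u; [apply/uE|rewrite /M (big_rem n)//= leq_maxl].
have [an0|n0M] := leqP `|n0|%N M; last first.
  by apply: contrapT => /eqP /uM; rewrite leqNgt n0M.
pose r := [seq (i%:Z - M%:Z)%R | i <- iota 0 (2 * M).+1].
have ur : uniq r by rewrite map_inj_uniq ?iota_uniq// => i j; lia.
have inr n : (`|n| <= M)%N -> n \in r.
  move=> nM; apply/mapP; exists ((absz (n + M%:Z))); last lia.
  by rewrite mem_iota; lia.
have := a0; rewrite (@fsum_seq _ _ _ _ r)// => [|n _ nr]; last first.
  by have [->|/uM /inr] := eqVneq (a n) 0; rewrite ?mulr0z// (negPf nr).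
rewrite big_map -/(index_iota 0 (2 * M).+1) big_mkord.
rewrite (_ : \sum_(i < _) _ = v ^ (- M%:Z) * evz v (\poly_(i < (2 * M).+1) a (i%:Z - M%:Z))); last first.
  rewrite evz_poly mulr_sumr; apply: eq_bigr => i _.
  by rewrite -[LHS]mulrzl exprzDr ?v_unit// [RHS]mulrCA; congr (_ * _); rewrite mulrC.
move/eqP; rewrite mulf_eq0 expfz_eq0 (negPf v_neq0) andbF /= => /eqP /evz_v_inj P0.
have := congr1 (fun Q : {poly int} => Q`_((absz (n0 + M%:Z)))) P0.
by rewrite coef_poly coef0; case: ifP => [_ <-|]; [congr a; lia|lia].
Qed.

Lemma laurent_coefE (a : int -> int) : finsupp_on [set: int] a ->
  laurent_coef (\sum_(n \in [set: int]) (v ^ n *~ a n)) = a.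
Proof.
move=> fa; set f := \sum_(n \in _) _.
have [] := @xgetPex _ (fun=> 0) [set a | finsupp_on [set: int] a /\
   f = \sum_(n \in [set: int]) (v ^ n *~ a n)]; first by exists a.
move=> fb e; apply: funext => n.
by apply: (Zfree_inj vpow_free fb fa _ (I : [set: int] n)); rewrite -e.
Qed.

Lemma fsum_evz (N : int) (P : {poly int}) : v ^ N * evz v^-1 P =
  \sum_(n \in [set: int]) (v ^ n *~ (if (n <= N)%R then P`_(`|N - n|%N) else 0)).
Proof.
pose r := [seq (N - i%:Z)%R | i <- iota 0 (size P)].
have ur : uniq r by rewrite map_inj_uniq ?iota_uniq// => i j; lia.
rewrite (@fsum_seq _ _ _ _ r)// => [|n _ nr].
  rewrite big_map -[X in iota _ X]subn0 -/(index_iota 0 (size P)) big_mkord evz_sum mulr_sumr.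
  apply: eq_bigr => i _; rewrite ifT; last by lia.
  rewrite exprzDr ?v_unit// -[RHS]mulrzl mulrCA; congr (_%:~R * (_ * _)).
    by congr (P`_ _); lia.
  by rewrite exprVn exprnN.
case: ifP => // nN; rewrite nth_default ?mulr0z// leqNgt; apply: contra nr => nP.
apply/mapP; exists `|N - n|%N; first by rewrite mem_iota add0n.
by rewrite gez0_abs ?subr_ge0// opprB addrC subrK.
Qed.

Lemma finsupp_evz (N : int) (P : {poly int}) :
  finsupp_on [set: int] (fun n : int => if (n <= N)%R then P`_(`|N - n|%N) else 0).
Proof.
pose r := [seq (N - i%:Z)%R | i <- iota 0 (size P)].
apply: (@finsuppP _ _ _ _ r) => n _ nr.
case: ifP => // nN; rewrite nth_default// leqNgt; apply: contra nr => nP.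
apply/mapP; exists `|N - n|%N; first by rewrite mem_iota add0n.
by rewrite gez0_abs ?subr_ge0// opprB addrC subrK.
Qed.

Lemma laurent_coef_evz N P : laurent_coef (v ^ N * evz v^-1 P) N = P`_0.
Proof. by rewrite fsum_evz (laurent_coefE (finsupp_evz N P)) lexx subrr. Qed.

Lemma laurent_leP N f : laurent [set n | (n <= N)%R] f <-> exists P, f = v ^ N * evz v^-1 P.
Proof.
split=> [|[P ->]].
  move: f; apply: Zspan_min => [|_ _ [P ->] [Q ->]|n nN].
  - by exists 0; rewrite (evzC _ 0) mulr0.
  - by exists (P - Q); rewrite evzB mulrBr.
  - exists 'X^`|N - n|; rewrite evzXn exprVn exprnN -exprzDr ?v_unit//; congr (_ ^ _).
    by move: nN => /=; lia.
rewrite evz_sum mulr_sumr; elim/big_ind: _ => [|x y|i _]; [exact: Zspan0|exact: ZspanD|].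
rewrite mulrCA exprVn exprnN -exprzDr ?v_unit// mulrzl.
by apply: (@Zspan_mulz _ _ [set n | (n <= N)%R] (fun n => v ^ n)) => /=; lia.
Qed.

(** The filtration of the Laurent polynomials by the subgroups v^N Z[v^-1],
    in a form that makes the closure under products immediate. *)
Definition vle (N : int) (f : Qv) : Prop := exists P, f = v ^ N * evz v^-1 P.

Lemma vleW M N f : (M <= N)%R -> vle M f -> vle N f.
Proof.
move=> MN [P ->]; exists ('X^`|N - M| * P); rewrite evzM evzXn mulrA; congr (_ * _).
rewrite exprVn exprnN -exprzDr ?v_unit// gez0_abs ?subr_ge0//; congr (_ ^ _).
by rewrite opprB addrC subrK.
Qed.

Lemma vle0 N : vle N 0.
Proof. by exists 0; rewrite (evzC _ 0) mulr0. Qed.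

Lemma vleB N f g : vle N f -> vle N g -> vle N (f - g).
Proof. by move=> [P ->] [Q ->]; exists (P - Q); rewrite evzB mulrBr. Qed.

Lemma vleN N f : vle N f -> vle N (- f).
Proof. by rewrite -sub0r; apply: vleB; apply: vle0. Qed.

Lemma vleD N f g : vle N f -> vle N g -> vle N (f + g).
Proof. by move=> fN gN; rewrite -[g]opprK; apply/vleB/vleN. Qed.

Lemma vleM M N f g : vle M f -> vle N g -> vle (M + N) (f * g).
Proof.
by move=> [P ->] [Q ->]; exists (P * Q); rewrite evzM exprzDr ?v_unit// mulrACA.
Qed.

Lemma vle_sum N (J : Type) (r : seq J) (P : pred J) (F : J -> Qv) :
  (forall i, P i -> vle N (F i)) -> vle N (\sum_(i <- r | P i) F i).
Proof. by move=> FN; elim/big_ind: _ => //; [exact: vle0|exact: vleD]. Qed.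

Lemma vle_pow (n : int) : vle n (v ^ n).
Proof. by exists 1; rewrite (evzC _ 1) mulr1. Qed.

Lemma vle1 : vle 0 1.
Proof. exact: (vle_pow 0). Qed.

Lemma vle_laurent N f : vle N f <-> laurent [set n | (n <= N)%R] f.
Proof. by split=> /laurent_leP. Qed.

Lemma vle_neg f : laurent [set n | (n < 0)%R] f -> vle (-1) f.
Proof.
move=> h; apply/vle_laurent.
by have -> : [set n | (n <= -1)%R] = [set n : int | (n < 0)%R]; [apply/seteqP; split=> n /=; lia|].
Qed.

Definition laurent_poly f := exists N, vle N f.

Lemma laurent_polyB f g : laurent_poly f -> laurent_poly g -> laurent_poly (f - g).
Proof.
move=> [M fM] [N gN]; exists (Order.max M N); apply: vleB.
  by apply: vleW fM; rewrite le_max lexx.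
by apply: vleW gN; rewrite le_max lexx orbT.
Qed.

Lemma laurent_polyM f g : laurent_poly f -> laurent_poly g -> laurent_poly (f * g).
Proof. by move=> [M fM] [N gN]; exists (M + N); apply: vleM. Qed.

Lemma evz_vV_inj P : evz v^-1 P = 0 -> P = 0.
Proof.
move=> P0; apply/polyP => i; rewrite coef0.
have := fsum_evz 0 P; rewrite P0 mulr0 => /esym.
move=> /(vpow_free (finsupp_evz 0 P)) /(_ (- i%:Z) I).
by rewrite oppr_le0 lez_nat/= sub0r opprK.
Qed.

(** The left side only involves negative powers of v and the right side only
    positive ones.  Clearing denominators makes this a comparison of sizes of
    polynomials. *)
Lemma evz_self_dual P : v^-1 * evz v^-1 P = v * evz v P -> P = 0.
Proof.
move=> e; apply/eqP; apply: contraT => P0; set d := size P.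
pose Q := \poly_(i < d) P`_(d.-1 - i).
have eQ : evz v Q = evz v ('X^(d.+1) * P).
  rewrite evzM evzXn exprSr -mulrA -e mulrA evz_poly evz_sum mulr_sumr.
  rewrite (reindex_inj rev_ord_inj) /=; apply: eq_bigr => i _.
  have di : (i < d)%N by [].
  rewrite (_ : (d.-1 - (d - i.+1))%N = i); last by lia.
  rewrite [RHS]mulrCA exprB ?v_unit// exprS invfM exprVn mulrA.
  by rewrite -!mulrA.
have QE : Q = 'X^(d.+1) * P.
  by apply/eqP; rewrite -subr_eq0; apply/eqP/evz_v_inj; rewrite evzB eQ subrr.
have := size_poly d (fun i => P`_(d.-1 - i)); rewrite -/Q QE size_monicM ?monicXn//.
by rewrite size_polyXn -/d; lia.
Qed.

Lemma evz_invariant P : evz v^-1 P = evz v P -> evz v^-1 P = (P`_0)%:~R.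
Proof.
have [c [Q ->]] : exists c Q, P = Q * 'X + c%:P.
  by elim/poly_ind: P => [|Q c _]; [exists 0, 0; rewrite mul0r addr0|exists c, Q].
rewrite !evzD !evzM !evzX !evzC => /addIr e.
have -> : Q = 0 by apply: evz_self_dual; rewrite mulrC e mulrC.
by rewrite mul0r add0r coefC (evzC _ 0) mul0r add0r.
Qed.

(** If r had a leading term v^n with n > 0, the constant term 1 of the other
    factor would keep this term in the product. *)
Lemma vle_divide (U : {poly int}) r : U`_0 = 1 -> laurent_poly r -> vle 0 (evz v^-1 U * r) -> vle 0 r.
Proof.
move=> U0 [N rN] [Q]; rewrite expr0z mul1r.
have {rN} : vle (`|N|%N) r by apply: vleW rN; lia.
elim: `|N|%N r => // m IH r [R rE] UrQ; apply: IH => //.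
have UR : U * R = 'X^(m.+1) * Q.
  apply/eqP; rewrite -subr_eq0; apply/eqP/evz_vV_inj.
  rewrite evzB !evzM evzXn -UrQ rE exprVn.
  have vn : v ^+ m.+1 != 0 by rewrite expf_neq0 ?v_neq0.
  by rewrite -exprnP mulrCA (mulrA _^-1) mulVf// mul1r subrr.
have R0 : R`_0 = 0.
  have := congr1 (fun P : {poly int} => P`_0) UR.
  by rewrite coef0M U0 mul1r coef0M coefXn mul0r.
exists (\poly_(i < size R) R`_i.+1); rewrite rE.
have RX : R = 'X * \poly_(i < size R) R`_i.+1.
  apply/polyP => i; rewrite coefXM coef_poly; case: i => [|i]/=; first exact: R0.
  by case: ifP => // /negbT; rewrite -leqNgt => Ri; rewrite nth_default// ltnW.
rewrite {1}RX evzM evzX mulrA; congr (_ * _).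
by rewrite -!exprnP exprSr mulfK ?v_neq0//.
Qed.

(** * Matching free integral spans, and bilinearity of the product on J *)

Section SpanBijection.
Variables (I : choiceType) (V V' : zmodType) (D : set I) (e : I -> V) (e' : I -> V').
Hypothesis free : Zfree D e.
Hypothesis free' : Zfree D e'.

Definition Zcoef (x : V) : I -> int :=
  xget (fun=> 0) [set a | finsupp_on D a /\ x = \sum_(i \in D) (e i *~ a i)].

Definition Zmap (x : V) : V' := \sum_(i \in D) (e' i *~ Zcoef x i).

(** Freeness of e makes Zmap independent of the chosen coordinates. *)
Lemma ZmapE a : finsupp_on D a ->
  Zmap (\sum_(i \in D) (e i *~ a i)) = \sum_(i \in D) (e' i *~ a i).
Proof.
move=> fa; set x := \sum_(i \in D) _.
have [fb xb] : finsupp_on D (Zcoef x) /\ x = \sum_(i \in D) (e i *~ Zcoef x i).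
  apply: (@xgetPex _ _ [set a | finsupp_on D a /\ x = \sum_(i \in D) (e i *~ a i)]).
  by exists a.
apply: eq_fsbigr => i; rewrite inE => Di; congr (_ *~ _).
by apply: (Zfree_inj free fb fa) => //; rewrite -xb.
Qed.

Lemma ZmapB x y : Zspan D e x -> Zspan D e y -> Zmap (x - y) = Zmap x - Zmap y.
Proof.
move=> [a fa ->] [b fb ->]; rewrite -fsum_mulzB// !ZmapE// ?fsum_mulzB//.
exact: finsupp_mapzB.
Qed.

Lemma Zmap0 : Zmap 0 = 0.
Proof. by rewrite -(subrr 0) ZmapB ?subrr//; apply: Zspan0. Qed.

Lemma ZmapD x y : Zspan D e x -> Zspan D e y -> Zmap (x + y) = Zmap x + Zmap y.
Proof.
move=> xD yD; have := ZmapB (ZspanD xD yD) yD; rewrite addrK => ->.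
by rewrite subrK.
Qed.

Lemma Zmap_gen i : D i -> Zmap (e i) = e' i.
Proof.
move=> Di; have := ZmapE (finsupp_delta D i (1 : int)).
by rewrite !(@fsum_delta _ _ _ _ i)// ?eqxx// => j /negPf ->.
Qed.

Lemma Zmap_bij : set_bij (Zspan D e) (Zspan D e') Zmap.
Proof.
split=> [x [a fa ->]|x y|_ [a fa ->]].
- by rewrite ZmapE//; exists a.
- rewrite !inE => -[a fa ->] [b fb ->]; rewrite !ZmapE// => ab.
  apply: eq_fsbigr => i; rewrite inE => Di; congr (_ *~ _).
  exact: (Zfree_inj free' fa fb ab).
- by exists (\sum_(i \in D) (e i *~ a i)); [exists a|rewrite ZmapE].
Qed.

End SpanBijection.

Section JProduct.
Variables (W : groupType) (N : W -> W -> W -> int).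
Implicit Types (a b : Jgroup W) (x y : W) (u : seq W).

Definition Jcoef x y : Jgroup W := \sum_(z \in [set: W]) (tau z *~ N x y z).

Lemma Jmul_seq u u' a b : uniq u -> uniq u' ->
  {subset dom a <= u} -> {subset dom b <= u'} ->
  Jmul N a b = \sum_(x <- u) \sum_(y <- u') Jcoef x y *~ (coeff x a * coeff y b).
Proof.
move=> uu uu' au bu'.
have widen (d : Jgroup W) r (F : W -> Jgroup W) : uniq r -> {subset dom d <= r} ->
    (forall x, coeff x d = 0 -> F x = 0) -> \sum_(x <- dom d) F x = \sum_(x <- r) F x.
  move=> ur dr F0; rewrite [RHS](bigID (mem (dom d)))/= [X in _ + X]big1 ?addr0; last first.
    by move=> x xd; apply: F0; apply: coeff_outdom.
  rewrite -[RHS]big_filter; apply: perm_big; apply: uniq_perm.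
  - exact: uniq_dom.
  - exact: filter_uniq.
  - by move=> x; rewrite mem_filter; apply/idP/andP => [xd|[]//]; split=> //; apply: dr.
rewrite /Jmul (widen a u)// => [|x xa].
  apply: eq_bigr => x _; apply: widen => // y yb.
  by rewrite yb mulr0 mulr0z.
by rewrite big1// => y _; rewrite xa mul0r mulr0z.
Qed.

Lemma JmulBl a1 a2 b : Jmul N (a1 - a2) b = Jmul N a1 b - Jmul N a2 b.
Proof.
pose u := undup (dom a1 ++ dom a2 ++ dom (a1 - a2)).
have uu : uniq u by exact: undup_uniq.
rewrite !(@Jmul_seq u (dom b)) ?uniq_dom//; last first.
- by move=> x xa; rewrite mem_undup !mem_cat xa ?orbT.
- by move=> x xa; rewrite mem_undup !mem_cat xa ?orbT.
- by move=> x xa; rewrite mem_undup !mem_cat xa ?orbT.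
rewrite -sumrB; apply: eq_bigr => x _; rewrite -sumrB; apply: eq_bigr => y _.
by rewrite coeffB mulrBl mulrzBr.
Qed.

Lemma JmulBr a b1 b2 : Jmul N a (b1 - b2) = Jmul N a b1 - Jmul N a b2.
Proof.
pose u := undup (dom b1 ++ dom b2 ++ dom (b1 - b2)).
have uu : uniq u by exact: undup_uniq.
rewrite !(@Jmul_seq (dom a) u) ?uniq_dom//; last first.
- by move=> x xa; rewrite mem_undup !mem_cat xa ?orbT.
- by move=> x xa; rewrite mem_undup !mem_cat xa ?orbT.
- by move=> x xa; rewrite mem_undup !mem_cat xa ?orbT.
rewrite -sumrB; apply: eq_bigr => x _; rewrite -sumrB; apply: eq_bigr => y _.
by rewrite coeffB mulrBr mulrzBr.
Qed.

Lemma Jmul0l b : Jmul N 0 b = 0.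
Proof. by have := JmulBl 0 0 b; rewrite !subrr. Qed.

Lemma Jmul0r a : Jmul N a 0 = 0.
Proof. by have := JmulBr a 0 0; rewrite !subrr. Qed.

Lemma coeff_tau x y : coeff y (tau x) = (x == y)%:R.
Proof. by rewrite /tau coeffU mul1r. Qed.

Lemma Jmul_tau x y : Jmul N (tau x) (tau y) = Jcoef x y.
Proof.
rewrite (@Jmul_seq [:: x] [:: y])// => [|z|z]; rewrite ?domU1//.
by rewrite !big_seq1 !coeff_tau !eqxx mulr1.
Qed.

Lemma coeff_tau_mulz x y (k : int) : coeff y (tau x *~ k) = (x == y)%:R * k.
Proof. by rewrite -coeff_tau raddfMz -mulrzr intz. Qed.

End JProduct.

(** * Coordinates in a linearly independent family *)

Section Coordinates.
Variables (K : fieldType) (V : lmodType K) (I : choiceType) (e : I -> V).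
Implicit Types (a b : I -> K) (x y : V) (u : seq I).

Definition lin_indep := forall x a b, coords_spec e x a -> coords_spec e x b -> a = b.

Lemma basis_indep : is_basis e -> lin_indep.
Proof. by move=> be x a b xa xb; have [c [_ cu]] := be x; rewrite -(cu _ xa) -(cu _ xb). Qed.

Lemma basis_coords x : is_basis e -> coords_spec e x (coords e x).
Proof. by move=> be; have [a [xa _]] := be x; apply: (@xgetPex _ _ (coords_spec e x)); exists a. Qed.

Lemma coords_unique x a : lin_indep -> coords_spec e x a -> coords e x = a.
Proof.
by move=> indep xa; apply: (indep x) => //; apply: (@xgetPex _ _ (coords_spec e x)); exists a.
Qed.

Lemma coords_specP x a : coords_spec e x a <->
  exists u, [/\ uniq u, forall i, i \notin u -> a i = 0 & x = \sum_(i <- u) a i *: e i].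
Proof.
split=> [[/finsupp_seq [u uu uE] ->]|[u [uu ua ->]]].
  have ua i : i \notin u -> a i = 0.
    by move=> iu; apply/eqP; apply: contraNT iu => ai; apply/uE.
  exists u; split=> //; rewrite (@fsum_seq _ _ _ _ u)// => i _ /ua ->.
  by rewrite scale0r.
split; first by apply: (@finsuppP _ _ _ _ u) => i _; apply: ua.
by rewrite (@fsum_seq _ _ _ _ u)// => i _ /ua ->; rewrite scale0r.
Qed.

Lemma sum_support a u u' : uniq u -> uniq u' -> {subset u <= u'} ->
  (forall i, i \notin u -> a i = 0) ->
  \sum_(i <- u) a i *: e i = \sum_(i <- u') a i *: e i.
Proof.
move=> uu uu' sub ua; rewrite [RHS](bigID (mem u))/= [X in _ + X]big1 ?addr0; last first.
  by move=> i /ua ->; rewrite scale0r.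
rewrite -[RHS]big_filter; apply: perm_big; apply: uniq_perm; rewrite ?filter_uniq//.
by move=> i; rewrite mem_filter; apply/idP/andP => [iu|[]//]; split=> //; apply: sub.
Qed.

Lemma coords_spec_lin x y a b (t : K) : coords_spec e x a -> coords_spec e y b ->
  coords_spec e (x + t *: y) (fun i => a i + t * b i).
Proof.
move=> /coords_specP [u [uu ua ->]] /coords_specP [u' [uu' ub ->]]; apply/coords_specP.
exists (undup (u ++ u')); split=> [|i|]; first exact: undup_uniq.
  by rewrite mem_undup mem_cat => /norP [/ua -> /ub ->]; rewrite mulr0 addr0.
rewrite (@sum_support a u (undup (u ++ u')))// ?undup_uniq//; last first.
  by move=> i iu; rewrite mem_undup mem_cat iu.
rewrite (@sum_support b u' (undup (u ++ u')))// ?undup_uniq//; last first.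
  by move=> i iu; rewrite mem_undup mem_cat iu orbT.
rewrite scaler_sumr -big_split; apply: eq_bigr => i _ /=.
by rewrite scalerDl scalerA.
Qed.

Lemma coords_spec0 : coords_spec e 0 (fun=> 0).
Proof. by apply/coords_specP; exists [::]; rewrite big_nil. Qed.

Lemma coords_spec_gen j : coords_spec e (e j) (fun i => (i == j)%:R).
Proof.
apply/coords_specP; exists [:: j]; split=> // [i|]; first by rewrite inE => /negPf ->.
by rewrite big_seq1 eqxx scale1r.
Qed.

Lemma lin_indepP : (forall a, coords_spec e 0 a -> forall i, a i = 0) -> lin_indep.
Proof.
move=> h x a b xa xb; apply: funext => i; apply/eqP; rewrite -subr_eq0; apply/eqP.
have := coords_spec_lin (-1) xa xb; rewrite scaleN1r subrr => /h /(_ i).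
by rewrite mulN1r.
Qed.

Hypothesis be : is_basis e.
Local Notation cf := (coords e).

Let indep := basis_indep be.

Lemma coords_seq x : exists u, [/\ uniq u, forall i, i \notin u -> cf x i = 0 &
  x = \sum_(i <- u) cf x i *: e i].
Proof. exact/coords_specP/basis_coords. Qed.

Lemma coords_lin x y t i : cf (x + t *: y) i = cf x i + t * cf y i.
Proof.
by rewrite (coords_unique indep (coords_spec_lin t (basis_coords x be) (basis_coords y be))).
Qed.

Lemma coords0 i : cf 0 i = 0.
Proof. by rewrite (coords_unique indep coords_spec0). Qed.

Lemma coords_gen j i : cf (e j) i = (i == j)%:R.
Proof. by rewrite (coords_unique indep (coords_spec_gen j)). Qed.

Lemma coordsD x y i : cf (x + y) i = cf x i + cf y i.
Proof. by rewrite -[y]scale1r coords_lin scale1r mul1r. Qed.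

Lemma coordsZ t x i : cf (t *: x) i = t * cf x i.
Proof. by rewrite -[t *: x]add0r coords_lin coords0 add0r. Qed.

Lemma coordsN x i : cf (- x) i = - cf x i.
Proof. by rewrite -scaleN1r coordsZ mulN1r. Qed.

Lemma coordsB x y i : cf (x - y) i = cf x i - cf y i.
Proof. by rewrite coordsD coordsN. Qed.

Lemma coords_sum (J : Type) (r : seq J) (P : pred J) (F : J -> V) i :
  cf (\sum_(j <- r | P j) F j) i = \sum_(j <- r | P j) cf (F j) i.
Proof. by elim/big_rec2: _ => [|j y x _ <-]; rewrite ?coords0// coordsD. Qed.

Lemma coords_eq0 x : (forall i, cf x i = 0) -> x = 0.
Proof. by move=> x0; have [u [_ _ ->]] := coords_seq x; rewrite big1// => i _; rewrite x0 scale0r. Qed.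

Lemma coords_inj x y : (forall i, cf x i = cf y i) -> x = y.
Proof.
move=> xy; apply/eqP; rewrite -subr_eq0; apply/eqP/coords_eq0 => i.
by rewrite coordsB xy subrr.
Qed.

Lemma basis_ind (P : V -> Prop) : P 0 -> (forall x y, P x -> P y -> P (x + y)) ->
  (forall t x, P x -> P (t *: x)) -> (forall i, P (e i)) -> forall x, P x.
Proof.
move=> P0 PD PZ Pe x; have [u [_ _ ->]] := coords_seq x.
by elim/big_rec: _ => // i y _ Py; apply: PD => //; apply: PZ.
Qed.

End Coordinates.

(** * The canonical basis of the Hecke algebra *)

Section Hecke.
Variables (W : groupType) (S : set W) (L : W -> nat).
Hypothesis S_inv : forall s, S s -> (s * s = 1)%g.
Hypothesis S_gen : forall w, exists2 u, word S u & w = wprod u.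
Hypothesis S_len : forall s w, S s ->
  len S (s * w)%g = (len S w).+1 \/ len S w = (len S (s * w)%g).+1.
Hypothesis L_weight : weight_function S L.
Hypothesis L_pos : forall s, S s -> (0 < L s)%N.
Variables (H : algType Qv) (T : W -> H).
Hypothesis T_hecke : hecke_algebra S L T.
Variable bar : {rmorphism H -> H}.
Hypothesis bar_inv : bar_involution T bar.
Variable c : W -> H.
Hypothesis c_canon : forall w, canonical_element T bar w (c w).

Local Notation len := (len S).
Local Notation cf := (coords T).
Implicit Types (s w x y m e : W) (h g : H) (t : Qv).

Let be : is_basis T := hecke_basis T_hecke.

Lemma finite_longest (A : set W) (f : W -> nat) (x0 : W) : finite_set A -> A x0 ->
  exists2 x : W, A x & forall y : W, A y -> (f y <= f x)%N.
Proof. by move=> fA Ax; have [x xA xm] := finite_argmax f fA Ax; exists x. Qed.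

Definition xi s : Qv := v ^+ L s - v ^- L s.

Lemma T1 : T 1%g = 1.
Proof.
have T1r h : h * T 1%g = h.
  move: h; apply: (basis_ind be) => [|x y xE yE|t x xE|w]; rewrite ?mul0r ?mulrDl ?xE ?yE//.
    by rewrite -scalerAl xE.
  by rewrite (hecke_mul T_hecke) mulg1// (len1 S_gen) addn0.
by rewrite -[LHS]mul1r T1r.
Qed.

Lemma T_sq s : S s -> T s * T s = 1 + xi s *: T s.
Proof.
move=> Ss; have := hecke_quad T_hecke Ss.
rewrite mulrDl !mulrBr -!scalerAl -!scalerAr !mul1r !mulr1 scalerA mulVf ?expf_neq0 ?v_neq0//.
rewrite scale1r addrA => /eqP; rewrite subr_eq0 => /eqP e.
rewrite /xi scalerBl -e; by rewrite addrA [X in _ = X - _]addrAC subrK addrK.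
Qed.

Lemma T_inv s : S s -> bar (T s) = T s - (xi s)%:A.
Proof.
move=> Ss; have [b1 _] := bar_T bar_inv s.
rewrite (S_inve S_inv Ss) in b1.
have sT : T s * (T s - (xi s)%:A) = 1 by rewrite mulrBr T_sq// -scalerAr mulr1 addrK.
by rewrite -[LHS]mulr1 -[in LHS]sT mulrA b1 mul1r.
Qed.

(** ** Scalars under the bar involution *)

Lemma alg_inj t1 t2 : (t1%:A : H) = t2%:A -> t1 = t2.
Proof. exact: (fmorph_inj (in_alg H)). Qed.

Lemma bar_evz t1 t2 P : bar t1%:A = t2%:A -> bar (evz t1 P)%:A = (evz t2 P)%:A.
Proof.
move=> b12; elim/poly_ind: P => [|P n IH].
  by rewrite !(evzC _ 0) scale0r rmorph0.
rewrite !evzD !evzM !evzX !evzC !scalerDl rmorphD/=.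
have A (a b : Qv) : ((a * b)%:A : H) = a%:A * b%:A by rewrite -scalerAl mul1r scalerA.
have Z (k : int) : ((k%:~R)%:A : H) = k%:~R by rewrite -[LHS]/(in_alg H _) rmorph_int.
by rewrite !A !Z !rmorphM/= IH b12 rmorph_int.
Qed.

Lemma bar_vle n P : bar (v ^ n * evz v^-1 P)%:A = (v ^ (- n) * evz v P)%:A.
Proof.
have A (a b : Qv) : ((a * b)%:A : H) = a%:A * b%:A by rewrite -scalerAl mul1r scalerA.
rewrite !A rmorphM/= (bar_v bar_inv); congr (_ * _); apply: bar_evz.
by have := bar_v bar_inv (-1); rewrite opprK expr1z exprN1.
Qed.

Lemma bar_scale t1 t2 h : bar t1%:A = t2%:A -> bar (t1 *: h) = t2 *: bar h.
Proof. by move=> b12; rewrite -mulr_algl rmorphM/= b12 mulr_algl. Qed.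

Lemma bar_laurent t : laurent_poly t -> exists t', bar t%:A = t'%:A.
Proof. by move=> [n [P ->]]; exists (v ^ (- n) * evz v P); apply: bar_vle. Qed.

Lemma bar_neg t : vle (-1) t -> bar t%:A = t%:A -> t = 0.
Proof.
move=> [P ->]; rewrite bar_vle opprK exprN1 expr1z => /alg_inj /esym /evz_self_dual ->.
by rewrite (evzC _ 0) mulr0.
Qed.

Lemma bar_int t : vle 0 t -> bar t%:A = t%:A -> exists k : int, t = k%:~R.
Proof.
move=> [P ->]; rewrite bar_vle oppr0 !expr0z !mul1r => /alg_inj /esym /evz_invariant ->.
by exists P`_0.
Qed.

(** ** Multiplication by a generator on either side *)

(** Both one-sided multiplications by T_s satisfy these axioms, with a the
    corresponding translation of W by s. *)
Record generator_action s (a : W -> W) (op : H -> H) : Prop := {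
  ga_inv : forall w, a (a w) = w;
  ga_len : forall w, len (a w) = (len w).+1 \/ len w = (len (a w)).+1;
  ga_add : forall h g, op (h + g) = op h + op g;
  ga_scale : forall t h, op (t *: h) = t *: op h;
  ga_up : forall w, len (a w) = (len w).+1 -> op (T w) = T (a w);
  ga_weight : forall w, len (a w) = (len w).+1 -> L (a w) = (L w + L s)%N;
  ga_quad : forall h, op (op h) = h + xi s *: op h;
  ga_bar : forall h, bar (op h) = op (bar h) - xi s *: bar h }.

Lemma len_S s w : S s -> len (s * w)%g = (len w).+1 \/ len (w * s)%g = (len w).+1 -> len s = 1%N.
Proof.
move=> Ss up; apply/eqP; rewrite eqn_leq (len_S_le S_gen)//=.
by have := lenM S_gen s w; have := lenM S_gen w s; lia.
Qed.

Lemma left_action s : S s -> generator_action s (fun w => (s * w)%g) (fun h => T s * h).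
Proof.
move=> Ss; split=> [w|w|h g|t h|w up|w up|h|h].
- exact: (mulSK S_inv).
- exact: S_len.
- exact: mulrDr.
- by rewrite scalerAr.
- by rewrite (hecke_mul T_hecke)// up (len_S Ss (or_introl up)).
- by rewrite addnC L_weight// up (len_S Ss (or_introl up)).
- by rewrite mulrA T_sq// mulrDl mul1r scalerAl.
- by rewrite rmorphM/= T_inv// mulrBl mulr_algl.
Qed.

Lemma S_lenr s w : S s -> len (w * s)%g = (len w).+1 \/ len w = (len (w * s)%g).+1.
Proof.
move=> Ss; have := S_len (w^-1)%g Ss.
rewrite -{1 2}(S_inve S_inv Ss) -invgM !(lenV S_inv S_gen).
exact.
Qed.

Lemma right_action s : S s -> generator_action s (fun w => (w * s)%g) (fun h => h * T s).
Proof.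
move=> Ss; split=> [w|w|h g|t h|w up|w up|h|h].
- exact: (mulKS S_inv).
- exact: S_lenr.
- exact: mulrDl.
- by rewrite scalerAl.
- by rewrite (hecke_mul T_hecke)// up (len_S Ss (or_intror up)) addn1.
- by rewrite L_weight// up (len_S Ss (or_intror up)) addn1.
- by rewrite -mulrA T_sq// mulrDr mulr1 scalerAr.
- by rewrite rmorphM/= T_inv// mulrBr mulr_algr.
Qed.

Section Generator.
Variables (s : W) (a : W -> W) (op : H -> H).
Hypothesis ga : generator_action s a op.

Lemma ga_down w : len w = (len (a w)).+1 -> op (T w) = T (a w) + xi s *: T w.
Proof.
move=> down; have up : len (a (a w)) = (len (a w)).+1 by rewrite (ga_inv ga).
by have := ga_up ga up; rewrite (ga_inv ga) => <-; apply: ga_quad ga _.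
Qed.

Lemma ga0 : op 0 = 0.
Proof. by have := ga_scale ga 0 0; rewrite !scale0r. Qed.

Lemma ga_coords h w : cf (op h) w =
  cf h (a w) + (if (len (a w) < len w)%N then xi s * cf h w else 0).
Proof.
move: h; apply: (basis_ind be) => [|h g hE gE|t h hE|y].
- by rewrite ga0 !coords0// mulr0 if_same addr0.
- by rewrite (ga_add ga) !coordsD// hE gE; case: ifP => _; ring.
- by rewrite (ga_scale ga) !coordsZ// hE; case: ifP => _; ring.
have ay : (w == a y) = (a w == y) by apply/eqP/eqP => [->|<-]; rewrite (ga_inv ga).
have [up|down] := ga_len ga y.
  rewrite (ga_up ga)// !coords_gen// ay.
  case: (eqVneq w y) => [->|_]; last by rewrite mulr0 if_same addr0.
  by rewrite up ltnNge leqnSn addr0.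
rewrite ga_down// coordsD// coordsZ// !coords_gen// ay; congr (_ + _).
case: (eqVneq w y) => [->|_]; first by rewrite [X in (_ < X)%N]down ltnSn.
by rewrite mulr0 if_same.
Qed.

End Generator.

(** ** Triangularity *)

(** Induction along a reduced word, as bar T_s = T_s - xi_s. *)
Lemma bar_T_triangular w : cf (bar (T w)) w = 1 /\
  forall y, cf (bar (T w)) y != 0 -> y = w \/ (len y < len w)%N.
Proof.
have [k lk] := ubnP (len w); elim: k w lk => // k IH w lk.
have [->|/(word_descent S_gen) [s [w' [Ss wE lw]]]] := pselect (w = 1%g).
  rewrite T1 rmorph1 -T1 coords_gen// eqxx; split=> // y; rewrite coords_gen//.
  by case: (eqVneq y 1%g) => [->|_]; [left|rewrite eqxx].
have [b1 b2] := IH w' (leq_trans (eq_leq (esym lw)) lk).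
have sw' : (s * w)%g = w' by rewrite wE (mulSK S_inv).
have ga := left_action Ss.
have TE : T w = T s * T w' by rewrite (ga_up ga) -?wE.
have E y : cf (bar (T w)) y = cf (bar (T w')) (s * y)%g +
    ((if (len (s * y)%g < len y)%N then xi s * cf (bar (T w')) y else 0) - xi s * cf (bar (T w')) y).
  by rewrite TE (ga_bar ga) coordsB// coordsZ// (ga_coords ga) addrA.
split=> [|y].
  have z : cf (bar (T w')) w = 0.
    apply: contrapT => /eqP /b2 [e|]; last by rewrite lw ltnNge leqnSn.
    by move/eqP: lw; rewrite -e -[X in X == _]addn0 -addn1 eqn_add2l.
  by rewrite E sw' b1 z mulr0 if_same subrr addr0.
rewrite E; have [->|/b2 y1 _] := eqVneq (cf (bar (T w')) y) 0.
  rewrite mulr0 if_same subrr addr0 => /b2 [e|l1]; [left|right].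
    by rewrite wE -e (mulSK S_inv)//.
  have := len_sM S_gen (s * y)%g Ss.
  by rewrite (mulSK S_inv)// lw ltnS => l2; apply: leq_trans l2 _.
by right; rewrite lw ltnS; case: y1 => [->//|/ltnW].
Qed.

(** As bar T_w is T_w plus shorter terms, only T_y contributes to the
    coefficient of bar h at an element y of maximal length in the support. *)
Lemma bar_top h y : bar h = h -> (forall w, laurent_poly (cf h w)) ->
  (forall w, cf h w != 0 -> (len w <= len y)%N) -> bar (cf h y)%:A = (cf h y)%:A.
Proof.
move=> hb hl hy; have [u [uu ua hE]] := coords_seq be h.
have [yu|/ua ->] := boolP (y \in u); last by rewrite scale0r rmorph0.
pose g w := projT1 (cid (bar_laurent (hl w))).
have gE w : bar (cf h w)%:A = (g w)%:A by rewrite /g; case: cid.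
have e : cf (bar h) y = g y.
  rewrite {1}hE rmorph_sum coords_sum// (bigD1_seq y)//= big_seq_cond big1 => [|w /andP [wu wy]].
    by rewrite addr0 (bar_scale _ (gE y)) coordsZ// (proj1 (bar_T_triangular y)) mulr1.
  rewrite (bar_scale _ (gE w)) coordsZ//.
  have [w0|/hy wl] := eqVneq (cf h w) 0.
    have : (g w)%:A = 0 :> H by rewrite -gE w0 scale0r rmorph0.
    by rewrite -(scale0r 1) => /alg_inj ->; rewrite mul0r.
  have [->|/(proj2 (bar_T_triangular w)) [e|]] := eqVneq (cf (bar (T w)) y) 0.
  - by rewrite mulr0.
  - by rewrite e eqxx in wy.
  - by rewrite ltnNge wl.
by rewrite gE -e hb.
Qed.

Lemma bar_top_neg h y : bar h = h -> (forall w, laurent_poly (cf h w)) ->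
  (forall w, cf h w != 0 -> (len w <= len y)%N) -> vle (-1) (cf h y) -> cf h y = 0.
Proof. by move=> hb hl hy hn; apply: bar_neg => //; apply: bar_top. Qed.

Lemma longest_support h : h != 0 -> exists y, cf h y != 0 /\
  forall w, cf h w != 0 -> (len w <= len y)%N.
Proof.
move=> h0; have [y0 y0h] : exists y, cf h y != 0.
  apply: contrapT => /forallNP h0'; case/eqP: h0; apply: (coords_eq0 be) => i.
  by apply: contrapT => /eqP /h0'.
have [fh _] := basis_coords h be.
have fh' : finite_set [set w | cf h w != 0] by apply: sub_finite_set fh => w wh; split.
by have [y yh ymax] := finite_longest len fh' y0h; exists y.
Qed.

Lemma canonical_coords w : cf (c w) w = 1 /\
  forall y, y != w -> vle (-1) (cf (c w) y).
Proof.
have [_ [p [fp pn cE]]] := c_canon w.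
pose a y := if y == w then 1 else p y.
have spec : coords_spec T (c w) a.
  have [u uu uE] := finsupp_seq fp.
  have wu : w \notin u by apply/negP => /uE [/(_ erefl)].
  apply/coords_specP; exists (w :: u); split=> [|y|]; first by rewrite /= wu.
    rewrite inE => /norP [yw yu]; rewrite /a (negPf yw); apply/eqP.
    by apply: contraNT yu => py; apply/uE; split=> //; apply/eqP.
  rewrite big_cons /a eqxx scale1r cE; congr (_ + _).
  rewrite (@fsum_seq _ _ _ _ u)// => [|y /uE []//|y yw yu]; last first.
    have -> : p y = 0; last by rewrite scale0r.
    by apply/eqP; apply: contraNT yu => py; apply/uE.
  rewrite [LHS]big_seq [RHS]big_seq; apply: eq_bigr => y yu.
  by case: eqP yu => // ->; rewrite (negPf wu).
rewrite (coords_unique (basis_indep be) spec) /a eqxx; split=> // y yw.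
by rewrite (negPf yw); apply/vle_neg/pn.
Qed.

Lemma canonical_vle0 w y : vle 0 (cf (c w) y).
Proof.
have [cw cy] := canonical_coords w; have [->|/cy] := eqVneq y w.
  by rewrite cw; apply: vle1.
exact: vleW.
Qed.

Lemma bar_c w : bar (c w) = c w.
Proof. by case: (c_canon w). Qed.

(** A longest term of c_w other than T_w and at least as long would have a
    bar-invariant coefficient in v^-1 Z[v^-1], that is, the coefficient 0.  This
    replaces the Bruhat order, which the definition of c_w does not mention. *)
Lemma canonical_triangular w y : cf (c w) y != 0 -> y = w \/ (len y < len w)%N.
Proof.
have [cw cy] := canonical_coords w.
move=> y0; apply: contrapT => /not_orP [yw /negP lyw].
have fh' : finite_set [set z | cf (c w) z != 0 /\ z <> w].
  have [fh _] := basis_coords (c w) be.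
  by apply: sub_finite_set fh => z [wh _]; split.
have [z [zh zw] zmax] := finite_longest len fh' (conj y0 yw).
case/eqP: (zh); apply: bar_top_neg => [|x|x xh|].
- exact: bar_c.
- by exists 0; apply: canonical_vle0.
- have [->|xw] := pselect (x = w); last exact: (zmax x (conj xh xw)).
  by have := zmax y (conj y0 yw); lia.
- by apply: cy; apply/eqP.
Qed.

Lemma canonical_indep : lin_indep c.
Proof.
apply: lin_indepP => a /coords_specP [u [uu ua e0]] i; apply: contrapT => /eqP ai.
have fa : finite_set [set w | a w != 0].
  apply: sub_finite_set (finite_seq u) => w /= aw.
  by apply: contraNT aw => /ua ->.
have [w aw wmax] := finite_longest len fa ai.
have wu : w \in u by apply: contraNT aw => /ua ->.
have := congr1 (fun h => cf h w) e0; rewrite coords0// coords_sum// (bigD1_seq w)//=.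
rewrite coordsZ// (proj1 (canonical_coords w)) mulr1 big1 ?addr0 => [/esym/eqP|y yw].
  by rewrite (negPf aw).
rewrite coordsZ//; have [->|ay] := eqVneq (a y) 0; first by rewrite mul0r.
have [->|/canonical_triangular [e|l]] := eqVneq (cf (c y) w) 0; first by rewrite mulr0.
  by rewrite e eqxx in yw.
by have := wmax y ay; lia.
Qed.

(** ** Descents of the canonical basis *)

Section Descent.
Variables (s : W) (a : W -> W) (op : H -> H).
Hypothesis Ss : S s.
Hypothesis ga : generator_action s a op.
Local Notation q := (v ^+ L s).

Lemma vle_qV : vle (-1) (v ^- L s).
Proof. by apply: (@vleW (- (L s)%:Z)); [have := L_pos Ss; lia|rewrite exprnN; apply: vle_pow]. Qed.

Lemma q_neq0 : q != 0.
Proof. by rewrite expf_neq0 ?v_neq0. Qed.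

(** The difference k of the two sides is bar-invariant, its coefficients at the
    elements that a shortens lie in v^-1 Z[v^-1], and the remaining ones are
    multiples of these, so k vanishes by its longest terms. *)
Lemma canonical_descent m : len m = (len (a m)).+1 -> op (c m) = q *: c m.
Proof.
move=> down; apply/eqP; rewrite -subr_eq0; apply: contraT => k0.
set k := op (c m) - q *: c m in k0; have [cm cy] := canonical_coords m.
have bq : bar q%:A = (v ^- L s)%:A by rewrite exprnP (bar_v bar_inv) exprnN.
have kb : bar k = k.
  rewrite /k rmorphB/= (ga_bar ga) (bar_scale _ bq) bar_c /xi scalerBl.
  by rewrite opprB addrA addrAC addrK.
have kE y : cf k y = cf (c m) (a y) +
    (if (len (a y) < len y)%N then xi s * cf (c m) y else 0) - q * cf (c m) y.
  by rewrite /k coordsB// coordsZ// (ga_coords ga).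
have kdown y : len y = (len (a y)).+1 -> cf k y = cf (c m) (a y) - v ^- L s * cf (c m) y.
  by move=> dy; rewrite kE [X in (_ < X)%N]dy ltnSn /xi mulrBl addrA addrAC addrK.
have kup y : len (a y) = (len y).+1 -> cf k y = - q * cf k (a y).
  move=> uy; have day : len (a y) = (len (a (a y))).+1 by rewrite (ga_inv ga).
  rewrite kE uy ltnNge leqnSn addr0 (kdown _ day) (ga_inv ga).
  by rewrite mulrBr !mulNr opprK mulVKf ?q_neq0// addrC.
have [y [yk ymax]] := longest_support k0.
have dy : len y = (len (a y)).+1.
  have [uy|//] := ga_len ga y.
  have : cf k (a y) != 0 by apply: contraNN yk => /eqP e; rewrite (kup _ uy) e mulr0.
  by move=> /ymax; rewrite uy ltnn.
have ay : a y != m by apply/eqP => e; move: down; rewrite -e (ga_inv ga) dy; lia.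
case/eqP: yk; apply: bar_top_neg => // [w|].
  have lc z : laurent_poly (cf (c m) z) by exists 0; apply: canonical_vle0.
  have lp (z : int) : laurent_poly (v ^ z) by exists z; apply: vle_pow.
  have [uw|dw] := ga_len ga w.
    have daw : len (a w) = (len (a (a w))).+1 by rewrite (ga_inv ga).
    rewrite kup// (kdown _ daw) (ga_inv ga); apply: laurent_polyM.
      by rewrite -sub0r; apply: laurent_polyB; [exists 0; apply: vle0|apply: (lp (L s))].
    by apply: laurent_polyB => //; apply: laurent_polyM => //; rewrite exprnN.
  rewrite kdown//; apply: laurent_polyB => //.
  by apply: laurent_polyM => //; rewrite exprnN.
rewrite kdown//; apply: vleB; first exact: cy.
by rewrite -[(-1)%R]addr0; apply: vleM; [apply: vle_qV|apply: canonical_vle0].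
Qed.

Lemma invariant_coords h w : op h = q *: h -> len (a w) = (len w).+1 ->
  cf h (a w) = q * cf h w.
Proof.
move=> hq up; have := ga_coords ga h w.
by rewrite hq coordsZ// up ltnNge leqnSn addr0 => ->.
Qed.

Lemma invariant_ratio h w : op h = q *: h ->
  v ^+ L w * cf h (a w) = v ^+ L (a w) * cf h w.
Proof.
move=> hq; have [up|down] := ga_len ga w.
  by rewrite (invariant_coords hq up) (ga_weight ga up) exprD mulrA.
have up : len (a (a w)) = (len (a w)).+1 by rewrite (ga_inv ga).
have := invariant_coords hq up; have := ga_weight ga up; rewrite (ga_inv ga) => -> ->.
by rewrite exprD mulrA.
Qed.

End Descent.

(** * Maximal elements of cosets of the parabolic subgroup *)

Variable s0 : W.
Hypothesis sd : special_data S s0.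
Local Notation W0 := (parabolic0 S s0).
Local Notation S0 := (S `\ s0).

Let W0_1 : W0 1%g.
Proof. by case: (generated_group S0). Qed.
Let W0_M x y : W0 x -> W0 y -> W0 (x * y)%g.
Proof. by case: (generated_group S0) => _ h _; apply: h. Qed.
Let W0_V x : W0 x -> W0 (x^-1)%g.
Proof. by case: (generated_group S0) => _ _; apply. Qed.

Lemma S0_ind (P : W -> Prop) : P 1%g -> (forall s e, S0 s -> P e -> P (s * e)%g) ->
  forall e, W0 e -> P e.
Proof. by move=> P1 PM; apply: generated_ind => // s [Ss _]; apply: S_inv. Qed.

Definition left_invariant h := forall s, S0 s -> T s * h = v ^+ L s *: h.
Definition right_invariant h := forall s, S0 s -> h * T s = v ^+ L s *: h.
Definition left_max m := forall s, S0 s -> len m = (len (s * m)%g).+1.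
Definition right_max m := forall s, S0 s -> len m = (len (m * s)%g).+1.

Lemma canonical_left m : left_max m -> left_invariant (c m).
Proof.
move=> lm s S0s; have [Ss _] := S0s.
by apply: (canonical_descent Ss (left_action Ss)); apply: lm.
Qed.

Lemma canonical_right m : right_max m -> right_invariant (c m).
Proof.
move=> lm s S0s; have [Ss _] := S0s.
by apply: (canonical_descent Ss (right_action Ss)); apply: lm.
Qed.

Lemma vpow_neq0 (n : nat) : v ^+ n != 0.
Proof. by rewrite expf_neq0 ?v_neq0. Qed.

Lemma ratio_trans (p1 p2 p3 : Qv) (a1 a2 a3 : Qv) : p2 != 0 ->
  p1 * a2 = p2 * a1 -> p2 * a3 = p3 * a2 -> p1 * a3 = p3 * a1.
Proof.
move=> p20 e1 e2; apply: (mulfI p20).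
by rewrite mulrCA e2 mulrCA e1 mulrCA.
Qed.

Lemma ratio_transv (p1 p2 p3 : Qv) h1 h2 h3 : p2 != 0 ->
  p1 *: h2 = p2 *: h1 -> p2 *: h3 = p3 *: h2 -> p1 *: h3 = p3 *: h1.
Proof.
move=> p20 e1 e2; apply: (scalerI p20).
by rewrite scalerA mulrC -scalerA e2 scalerA mulrC -scalerA e1 !scalerA mulrC.
Qed.

Lemma right_ratio h w e : right_invariant h -> W0 e ->
  v ^+ L w * cf h (w * e)%g = v ^+ L (w * e)%g * cf h w.
Proof.
move=> hr We; move: e We w; apply: S0_ind => [w|s e S0s IH w]; first by rewrite mulg1.
have [Ss _] := S0s; rewrite mulgA.
apply: (@ratio_trans _ (v ^+ L (w * s)%g) _ _ (cf h (w * s)%g)); first exact: vpow_neq0.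
  exact: (invariant_ratio (right_action Ss) w (hr _ S0s)).
exact: IH.
Qed.

Lemma left_ratio h w e : left_invariant h -> W0 e ->
  v ^+ L w * cf h (e * w)%g = v ^+ L (e * w)%g * cf h w.
Proof.
move=> hl We; move: e We w; apply: S0_ind => [w|s e S0s IH w]; first by rewrite mul1g.
have [Ss _] := S0s; rewrite -mulgA.
apply: (@ratio_trans _ (v ^+ L (e * w)%g) _ _ (cf h (e * w)%g)); first exact: vpow_neq0.
  exact: IH.
exact: (invariant_ratio (left_action Ss) _ (hl _ S0s)).
Qed.

Lemma T_ratio_generator h w s : S0 s -> left_invariant h ->
  v ^+ L w *: (T (w * s)%g * h) = v ^+ L (w * s)%g *: (T w * h).
Proof.
move=> S0s hl; have [Ss _] := S0s; have ga := right_action Ss.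
have step x : len (x * s)%g = (len x).+1 -> T (x * s)%g * h = v ^+ L s *: (T x * h).
  by move=> up; rewrite -(ga_up ga up) -mulrA hl// scalerAr.
have [up|down] := S_lenr w Ss.
  by rewrite step// (ga_weight ga up) exprD scalerA.
have up : len (w * s * s)%g = (len (w * s)%g).+1 by rewrite (mulKS S_inv).
have := step _ up; have := ga_weight ga up; rewrite (mulKS S_inv)// => -> ->.
by rewrite exprD scalerA.
Qed.

Lemma T_ratio h w e : left_invariant h -> W0 e ->
  v ^+ L w *: (T (w * e)%g * h) = v ^+ L (w * e)%g *: (T w * h).
Proof.
move=> hl We; move: e We w; apply: S0_ind => [w|s e S0s IH w]; first by rewrite mulg1.
rewrite mulgA; apply: (@ratio_transv _ (v ^+ L (w * s)%g) _ _ (T (w * s)%g * h)).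
- exact: vpow_neq0.
- exact: T_ratio_generator.
- exact: IH.
Qed.

Lemma vle_pow_le (M N : int) : vle N (v ^ M) -> (M <= N)%R.
Proof.
move=> [P e]; rewrite leNgt; apply/negP => NM.
have : evz v^-1 ('X^`|M - N| * P) = evz v^-1 1.
  rewrite evzM evzXn (evzC _ 1) exprVn exprnN.
  have -> : evz v^-1 P = v ^ (M - N).
    by rewrite exprzDr ?v_unit// e -invr_expz mulrAC mulfV ?mul1r// expfz_neq0// v_neq0.
  rewrite -exprzDr ?v_unit// gez0_abs ?subr_ge0 ?(ltW NM)//.
  by rewrite addNr.
move=> /eqP; rewrite -subr_eq0 -evzB => /eqP /evz_vV_inj /eqP; rewrite subr_eq0 => /eqP.
move=> /(congr1 (fun Q : {poly int} => Q`_0)); rewrite coef0M coefXn coef1.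
case: eqP; rewrite ?mul0r//.
by move: NM; lia.
Qed.

(** The hypothesis holds when w is obtained from a maximal element m by
    multiplication in W0: the coefficient v^(L w - L m) of T_w in c_m must then
    lie in v^-1 Z[v^-1].  Two maximal elements of a coset would each have a
    smaller weight than the other, so there is only one. *)
Lemma canonical_weight m w : v ^+ L m * cf (c m) w = v ^+ L w -> w != m -> (L w < L m)%N.
Proof.
move=> e wm; have : vle ((L m)%:Z - 1) (v ^ (L w)%:Z).
  by rewrite -exprnP -e exprnP; apply: vleM; [apply: vle_pow|apply: (proj2 (canonical_coords m))].
by move=> /vle_pow_le; lia.
Qed.

Lemma right_max_unique m e : right_max m -> W0 e -> right_max (m * e)%g -> e = 1%g.
Proof.
move=> rm We rme; apply: contrapT => e1.
have lt x f : right_max x -> W0 f -> f <> 1%g -> (L (x * f)%g < L x)%N.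
  move=> rx Wf f1; apply: canonical_weight.
    by rewrite (right_ratio _ (canonical_right rx) Wf) (proj1 (canonical_coords x)) mulr1.
  by apply/eqP => xf; apply: f1; apply: (mulgI x); rewrite mulg1.
have l1 := lt m e rm We e1.
have : (L (m * e * e^-1)%g < L (m * e)%g)%N.
  by apply: lt => //; [apply: W0_V|move=> /(congr1 (fun x => x^-1)%g); rewrite invgK invg1].
by rewrite mulgK ltnNge (ltnW l1).
Qed.

(** Among the f in W0 with len (w f) = len w + len f, take a longest one: a
    further ascent of w f would also be an ascent of f. *)
Lemma right_max_above w : exists f, [/\ W0 f, right_max (w * f)%g & len (w * f)%g = (len w + len f)%N].
Proof.
pose A := [set f | W0 f /\ len (w * f)%g = (len w + len f)%N].
have fA : finite_set A by apply: sub_finite_set (sd_finite sd) => f [].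
have A1 : A 1%g by split=> //; rewrite mulg1 (len1 S_gen) addn0.
have [f [Wf lf] fmax] := finite_longest len fA A1.
exists f; split=> // s S0s; have [Ss _] := S0s.
have [up|//] := S_lenr (w * f)%g Ss.
have lfs : len (w * (f * s))%g = (len w + len (f * s)%g)%N.
  apply/eqP; rewrite eqn_leq (lenM S_gen)/= mulgA up lf -addnS leq_add2l.
  by apply: leq_trans (lenM S_gen f s) _; rewrite -addn1 leq_add2l (len_S_le S_gen).
have := fmax _ (conj (W0_M Wf (generated_sub S0s)) lfs).
by move: lfs; rewrite mulgA up lf -addnS => /addnI <-; rewrite ltnn.
Qed.

(** The maximal element reached from m e by lengthening is m again, by
    uniqueness. *)
Lemma right_max_len m e : right_max m -> W0 e -> len m = (len (m * e)%g + len e)%N.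
Proof.
move=> rm We; have [f [Wf rf lf]] := right_max_above (m * e)%g.
have ef : (e * f)%g = 1%g by apply: (@right_max_unique m) => //; [apply: W0_M|rewrite mulgA].
have fe : f = (e^-1)%g by rewrite (mulg1_eq ef).
by move: lf; rewrite fe mulgK (lenV S_inv S_gen).
Qed.

Lemma left_max_inv m : left_max m <-> right_max (m^-1)%g.
Proof.
split=> h s S0s; have [Ss _] := S0s.
  by rewrite -(S_inve S_inv Ss) -invgM !(lenV S_inv S_gen); apply: h.
by have := h s S0s; rewrite -{1}(S_inve S_inv Ss) -invgM !(lenV S_inv S_gen).
Qed.

Lemma left_max_len m e : left_max m -> W0 e -> len m = (len (e * m)%g + len e)%N.
Proof.
move=> /left_max_inv rm We; have := right_max_len rm (W0_V We).
by rewrite -invgM !(lenV S_inv S_gen).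
Qed.

Lemma left_max_above w : exists f, [/\ W0 f, left_max (f * w)%g & len (f * w)%g = (len f + len w)%N].
Proof.
have [f [Wf rf lf]] := right_max_above (w^-1)%g; exists (f^-1)%g; split.
- exact: W0_V.
- by apply/left_max_inv; rewrite invgM invgK.
- by rewrite -[(f^-1 * w)%g]invgK invgM invgK !(lenV S_inv S_gen) lf (lenV S_inv S_gen) addnC.
Qed.

Lemma right_max_weight m e : right_max m -> W0 e -> L m = (L (m * e^-1)%g + L e)%N.
Proof.
move=> rm We; rewrite -L_weight ?mulgVK//.
by rewrite (right_max_len rm (W0_V We)) (lenV S_inv S_gen).
Qed.

(** Write the maximal element of W0 x as f x.  Minimality of x says that f^-1 is
    itself maximal in W0, so both len (e x) and len e are differences of lengths
    of maximal elements. *)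
Lemma left_min_len x e : (forall s, S0 s -> len (s * x)%g = (len x).+1) -> W0 e ->
  len (e * x)%g = (len e + len x)%N.
Proof.
move=> minx We; have [f [Wf lf lfx]] := left_max_above x.
have fV : left_max (f^-1)%g.
  move=> s S0s; have := left_max_len lf (W0_M (generated_sub S0s) (W0_V Wf)).
  have -> : (s * f^-1 * (f * x))%g = (s * x)%g by rewrite mulgA mulgVK.
  by have := minx _ S0s; have := lenV S_inv S_gen f; lia.
have := left_max_len lf (W0_M We (W0_V Wf)); have := left_max_len fV We.
have -> : (e * f^-1 * (f * x))%g = (e * x)%g by rewrite mulgA mulgVK.
by have := lenV S_inv S_gen f; lia.
Qed.

(** ** Double cosets *)

Definition double_max m := left_max m /\ right_max m.

(** The two-sided form of the comparison of weights. *)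
Lemma double_max_unique m a b : double_max m -> W0 a -> W0 b ->
  double_max (a * m * b)%g -> (a * m * b)%g = m.
Proof.
have lt x f (g : W) : double_max x -> W0 f -> W0 g -> (f * x * g)%g <> x -> (L (f * x * g)%g < L x)%N.
  move=> [lx rx] Wf Wg fx; apply: canonical_weight; last exact/eqP.
  rewrite -[RHS]mulr1; apply: (@ratio_trans _ (v ^+ L (f * x)%g) _ _ (cf (c x) (f * x)%g)).
  - exact: vpow_neq0.
  - by rewrite (left_ratio _ (canonical_left lx) Wf) (proj1 (canonical_coords x)).
  - exact: right_ratio (canonical_right rx) Wg.
move=> dm Wa Wb dn; apply: contrapT => nm; have l1 := lt _ _ _ dm Wa Wb nm.
have : (L (a^-1 * (a * m * b) * b^-1)%g < L (a * m * b)%g)%N.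
  by apply: lt => //; [exact: W0_V|exact: W0_V|];
    rewrite -!mulgA mulKg mulgV mulg1 => /esym; rewrite !mulgA.
by rewrite -!mulgA mulKg mulgV mulg1 ltnNge !mulgA (ltnW l1).
Qed.

Lemma Mmax_double x : exists a b,
  [/\ W0 a, W0 b, Mmax S s0 x = (a * x * b)%g & double_max (Mmax S s0 x)].
Proof.
have fD : finite_set (double_coset S s0 x).
  apply: (sub_finite_set _ (finite_image2 (fun a b => (a * x * b)%g) (sd_finite sd) (sd_finite sd))).
  by move=> _ [a [b [Wa Wb ->]]]; exists a => //; exists b.
have Dx : double_coset S s0 x x by exists 1%g, 1%g; rewrite mul1g mulg1.
have [m Dm mmax] := finite_longest len fD Dx.
have [[a [b [Wa Wb ME]]] Mm] : double_coset S s0 x (Mmax S s0 x) /\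
   forall w, double_coset S s0 x w -> (len w <= len (Mmax S s0 x))%N.
  apply: (@xgetPex _ 1%g [set m | double_coset S s0 x m /\
     forall w, double_coset S s0 x w -> (len w <= len m)%N]).
  by exists m.
exists a, b; split=> //; split=> s S0s; have [Ss _] := S0s.
  have [up|//] := S_len (Mmax S s0 x) Ss.
  have : (len (s * Mmax S s0 x)%g <= len (Mmax S s0 x))%N; last by rewrite up ltnn.
  apply: Mm; exists (s * a)%g, b; rewrite {1}ME !mulgA; split=> //.
  by apply: W0_M => //; apply: generated_sub.
have [up|//] := S_lenr (Mmax S s0 x) Ss.
have : (len (Mmax S s0 x * s)%g <= len (Mmax S s0 x))%N; last by rewrite up ltnn.
apply: Mm; exists a, (b * s)%g; rewrite {1}ME !mulgA; split=> //.
by apply: W0_M => //; apply: generated_sub.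
Qed.

(** By the decomposition of W as translations times W0, every double coset
    contains a translation, and by dominance an element of Q+. *)
Lemma double_max_Qplus w : double_max w -> exists2 z, Qplus S s0 z & w = Mmax S s0 z.
Proof.
move=> dw; have [x [u [Qx Wu wE]]] := sd_product sd w.
have [u' Wu' Qz] := sd_dominant sd Qx; set z := (u' * x * u'^-1)%g in Qz *.
exists z => //; have [a [b [Wa Wb ME dM]]] := Mmax_double z.
have e : Mmax S s0 z = (a * u' * w * (u^-1 * u'^-1 * b))%g.
  by rewrite ME wE /z !mulgA mulgK.
rewrite e; apply/esym; apply: double_max_unique => //.
- exact: W0_M.
- by apply: W0_M => //; apply: W0_M; apply: W0_V.
- by rewrite -e.
Qed.

Lemma Qplus_len x e : Qplus S s0 x -> W0 e -> len (e * x)%g = (len e + len x)%N.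
Proof. by move=> [_ minx]; apply: left_min_len. Qed.

(** Induction on the length of u.  Let s in S0 be a descent of u^-1.  Comparing
    the lengths of the two sides of x' u = u x and of u^-1 x' = x u^-1, where x'
    is the conjugate, shows that x s is longer than x.  As s x is longer than x
    too, x commutes with s, and u can be replaced by u s. *)
Lemma Qplus_conj x u : Qplus S s0 x -> Qplus S s0 (u * x * u^-1)%g -> W0 u ->
  (u * x * u^-1)%g = x.
Proof.
have [k lk] := ubnP (len u); elim: k u lk => // k IH u lk Qx Qx' Wu.
have [->|u1] := pselect (u = 1%g); first by rewrite mul1g invg1 mulg1.
have [s [S0s us]] : exists s, S0 s /\ len (u^-1)%g = (len (s * u^-1)%g).+1.
  apply: contrapT => /forallNP no; apply: u1; apply: (len_eq0 S_gen).
  have minu s : S0 s -> len (s * u^-1)%g = (len (u^-1)%g).+1.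
    move=> S0s; have [Ss _] := S0s; have [//|down] := S_len (u^-1)%g Ss.
    by case: (no s).
  by have := left_min_len minu Wu; rewrite mulgV (len1 S_gen); lia.
have [Ss _] := S0s; set x' := (u * x * u^-1)%g in Qx' *.
have xu : (x' * u)%g = (u * x)%g by rewrite /x' mulgVK.
have ux : (u^-1 * x')%g = (x * u^-1)%g by rewrite /x' !mulgA mulVg mul1g.
have l1 := Qplus_len Qx Wu; have l2 := Qplus_len Qx' (W0_V Wu).
rewrite ux in l2; rewrite -xu in l1.
have m1 := lenM S_gen x' u; have m2 := lenM S_gen x (u^-1)%g.
have m3 := lenM S_gen (x * s)%g (s * u^-1)%g.
have xs : (x * s * (s * u^-1))%g = (x * u^-1)%g by rewrite mulgA (mulKS S_inv).
rewrite xs in m3; rewrite (lenV S_inv S_gen) in l2 m2 us.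
have [Qtx minx] := Qx; have [lxs|comm] := sd_ascent sd Qtx Ss (minx _ S0s).
  by exfalso; lia.
have u's : (u * s * x * (u * s)^-1)%g = x'.
  by rewrite invgM (S_inve S_inv Ss) -(mulgA u) -comm !mulgA (mulKS S_inv).
rewrite -u's; apply: IH => //; last by apply: W0_M => //; apply: generated_sub.
  have : len (u * s)%g = len (s * u^-1)%g.
    by rewrite -(lenV S_inv S_gen (u * s)%g) invgM (S_inve S_inv Ss).
  by lia.
by rewrite u's.
Qed.

(** If y = f x g with f and g in W0, then f g is a translation in W0, hence 1:
    two elements of Q+ in one double coset are conjugate under W0. *)
Lemma Mmax_inj x y : Qplus S s0 x -> Qplus S s0 y -> Mmax S s0 x = Mmax S s0 y -> x = y.
Proof.
move=> Qx Qy; have [a [b [Wa Wb -> _]]] := Mmax_double x.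
have [a' [b' [Wa' Wb' -> _]]] := Mmax_double y => e.
have yE : y = (a'^-1 * a * x * (b * b'^-1))%g.
  by rewrite !mulgA -(mulgA _ b) -!mulgA (mulgA a) (mulgA (a * x)%g) e -!mulgA mulgV mulg1 mulKg.
have key (p r t : W) : (p * t)%g = ((p * r * p^-1)^-1 * (p * r * t))%g.
  by rewrite !invgM invgK !mulgA !mulgVK.
set f := (a'^-1 * a)%g in yE; set g := (b * b'^-1)%g in yE.
have Wf : W0 f by apply: W0_M => //; apply: W0_V.
have Wg : W0 g by apply: W0_M => //; apply: W0_V.
have [Qtx _] := Qx; have [Qty _] := Qy.
have fg : (f * g)%g = 1%g.
  apply: (sd_disjoint sd); first exact: W0_M.
  have -> : (f * g)%g = ((f * x * f^-1)^-1 * y)%g.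
    by rewrite yE; apply: key.
  by apply: translationsM => //; apply/translationsV/translationsJ.
have gE : g = (f^-1)%g by rewrite (mulg1_eq fg).
by rewrite yE gE; apply/esym; apply: Qplus_conj; rewrite // -gE -yE.
Qed.


Lemma v_intr_eq0 (k : int) : ((k%:~R : Qv) == 0) = (k == 0).
Proof.
apply/eqP/eqP => [k0|->//]; have := evz_v_inj (P := k%:P); rewrite evzC => /(_ k0) /eqP.
by rewrite polyC_eq0 => /eqP.
Qed.

(** ** The Poincare polynomial *)

Lemma W0_list_ex : exists u : seq W, uniq u /\ forall e, (e \in u) <-> W0 e.
Proof.
have /finite_seqP [u uE] := sd_finite sd; exists (undup u); split; first exact: undup_uniq.
by move=> e; rewrite mem_undup; rewrite (_ : W0 e = [set` u] e) // uE.
Qed.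

Definition W0_list : seq W := projT1 (cid W0_list_ex).

Lemma W0_list_uniq : uniq W0_list.
Proof. by rewrite /W0_list; case: cid => u []. Qed.

Lemma mem_W0_list e : (e \in W0_list) <-> W0 e.
Proof. by rewrite /W0_list; case: cid => u []. Qed.

Local Notation M0 := (Mmax S s0 1%g).
Local Notation N := (L M0).

Definition poincare_poly : {poly int} := \sum_(e <- W0_list) 'X^(2 * L e).

Lemma evz_poincare_poly (x : Qv) : evz x poincare_poly = \sum_(e <- W0_list) x ^+ (2 * L e)%N.
Proof.
rewrite /poincare_poly; elim/big_rec2: _ => [|e y P _ <-]; first exact: (evzC _ 0).
by rewrite evzD evzXn.
Qed.

Lemma poincareE : poincare S s0 L = evz v poincare_poly.
Proof.
rewrite evz_poincare_poly /poincare (@fsum_seq _ _ _ _ W0_list)//.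
- exact: W0_list_uniq.
- by move=> e; exact: (proj1 (mem_W0_list e)).
- by move=> e We /negP []; exact: (proj2 (mem_W0_list e) We).
Qed.

Lemma L1 : L 1%g = 0%N.
Proof. by have := @L_weight 1%g 1%g; rewrite mulg1 (len1 S_gen) => /(_ erefl); lia. Qed.

Lemma L_eq0 e : L e = 0%N -> e = 1%g.
Proof.
move=> e0; apply: contrapT => /(word_descent S_gen) [s [e' [Ss eE le]]].
have := ga_weight (left_action Ss) (w := e'); rewrite -eE => /(_ le).
by have := L_pos Ss; lia.
Qed.

(** Only e = 1 has weight 0, because L is positive on S. *)
Lemma poincare_poly0 : poincare_poly`_0 = 1.
Proof.
have W0l1 : 1%g \in W0_list by exact: (proj2 (mem_W0_list _) W0_1).
rewrite coef_sum (bigD1_seq 1%g) ?W0_list_uniq//=.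
rewrite L1 muln0 coefXn big1 ?addr0// => e e1.
rewrite coefXn; case: eqP => // e0; case/eqP: e1; apply: L_eq0.
by move: e0; lia.
Qed.

Lemma M0_parabolic : W0 M0.
Proof. by have [a [b [Wa Wb -> _]]] := Mmax_double 1%g; rewrite mulg1; apply: W0_M. Qed.

Lemma M0_right_max : right_max M0.
Proof. by have [_ [_ [_ _ _ []]]] := Mmax_double 1%g. Qed.

(** The bijection e -> M0 e^-1 of W0 replaces L e by N - L e. *)
Lemma poincare_dual : evz v poincare_poly = v ^ (2 * N)%N * evz v^-1 poincare_poly.
Proof.
rewrite !evz_poincare_poly mulr_sumr.
have /(perm_big _) -> : perm_eq W0_list [seq (M0 * e^-1)%g | e <- W0_list].
  apply: uniq_perm; first exact: W0_list_uniq.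
    by rewrite map_inj_uniq ?W0_list_uniq// => e e' /mulgI /invg_inj.
  move=> e; apply/idP/mapP => [/mem_W0_list We|[e' /mem_W0_list We' ->]].
    exists (e^-1 * M0)%g; last by rewrite invgM invgK mulVKg.
    by apply/mem_W0_list; apply: W0_M M0_parabolic; apply: W0_V.
  by apply/mem_W0_list; apply: W0_M; [apply: M0_parabolic|apply: W0_V].
rewrite big_map big_seq [RHS]big_seq; apply: eq_bigr => e /mem_W0_list We.
rewrite -exprnP exprVn.
have -> : (2 * N = 2 * L (M0 * e^-1)%g + 2 * L e)%N.
  by rewrite {1}(right_max_weight M0_right_max We) mulnDr.
by rewrite exprD -mulrA mulfV ?vpow_neq0// mulr1.
Qed.

(** This is v^-N times the Poincare polynomial, by its self-duality. *)
Definition pi_bal : Qv := v ^ N%:Z * evz v^-1 poincare_poly.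

Lemma pi_balE : poincare S s0 L = v ^ N%:Z * pi_bal.
Proof.
rewrite poincareE poincare_dual /pi_bal mulrA -exprzDr ?v_unit//.
by congr (v ^ _ * _); lia.
Qed.

Lemma bar_pi_bal : bar pi_bal%:A = pi_bal%:A.
Proof.
rewrite bar_vle poincare_dual mulrA -exprzDr ?v_unit//.
by congr ((v ^ _ * _)%:A); lia.
Qed.

Lemma evz_poincare_neq0 : evz v^-1 poincare_poly != 0.
Proof.
apply/eqP => /evz_vV_inj e; have := poincare_poly0; rewrite e coef0 => /esym/eqP.
by rewrite oner_eq0.
Qed.

Lemma pi_bal_neq0 : pi_bal != 0.
Proof.
rewrite /pi_bal mulf_neq0//; last exact: evz_poincare_neq0.
exact: (expfz_neq0 _ v_neq0).
Qed.

(** ** Products of invariant elements *)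

(** For m maximal in m W0, the right-invariant element supported on this coset
    with coefficient 1 at m. *)
Definition coset_sum m : H := \sum_(e <- W0_list) v ^- L e *: T (m * e^-1)%g.

Lemma coset_sum_coords m w : right_max m -> cf (coset_sum m) w != 0 ->
  exists2 e, W0 e & w = (m * e^-1)%g.
Proof.
move=> rm w0; apply: contrapT => /forall2NP no; case/eqP: w0.
rewrite coords_sum// big_seq big1// => e /mem_W0_list We.
rewrite coordsZ// coords_gen//; case: eqP => [we|]; last by rewrite mulr0.
by case: (no e).
Qed.

Lemma coset_sum_coords_in m e : W0 e -> cf (coset_sum m) (m * e^-1)%g = v ^- L e.
Proof.
move=> /mem_W0_list We; rewrite coords_sum// (bigD1_seq e) ?W0_list_uniq//=.
rewrite coordsZ// coords_gen// eqxx mulr1 big1 ?addr0// => e' ee'.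
rewrite coordsZ// coords_gen//; case: eqP => [/mulgI /invg_inj e1|]; last by rewrite mulr0.
by rewrite e1 eqxx in ee'.
Qed.

(** Invariance determines the coefficients on a coset of W0 from the one at its
    maximal element. *)
Lemma right_invariant_expand h : right_invariant h -> exists2 u : seq W,
  forall m, m \in u -> right_max m & h = \sum_(m <- u) cf h m *: coset_sum m.
Proof.
move=> hr; have [u [uu ua _]] := coords_seq be h.
pose um := [seq m <- u | `[< right_max m >]].
have um_rm m : m \in um -> right_max m by rewrite mem_filter => /andP [/asboolP].
exists um => //; apply: (coords_inj be) => w; rewrite coords_sum//.
have [f [Wf rf lf]] := right_max_above w.
have wE : w = (w * f * f^-1)%g by rewrite mulgK.
have hw : cf h w = cf h (w * f)%g * v ^- L f.
  have := right_ratio w hr Wf; rewrite (right_max_weight rf Wf) -wE exprD -mulrA.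
  by move=> /(mulfI (vpow_neq0 _)) ->; rewrite mulrAC mulfV ?mul1r// vpow_neq0.
have [wum|wum] := boolP ((w * f)%g \in um).
  have cw : cf (coset_sum (w * f)%g) w = v ^- L f by rewrite {2}wE coset_sum_coords_in.
  rewrite (bigD1_seq (w * f)%g) ?filter_uniq//= coordsZ// cw.
  rewrite -hw big_seq_cond big1 ?addr0// => m /andP [/um_rm rm mf].
  rewrite coordsZ//; have [->|/(coset_sum_coords rm) [e We we]] := eqVneq (cf (coset_sum m) w) 0.
    by rewrite mulr0.
  case/eqP: mf; have mE : m = (w * f * (f^-1 * e))%g by rewrite mulgA mulgK we mulgVK.
  rewrite mE (right_max_unique rf (W0_M (W0_V Wf) We)) ?mulg1//.
  by rewrite -mE.
have hwf : cf h (w * f)%g = 0.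
  by apply: ua; apply: contra wum => wu; rewrite mem_filter wu andbT; apply/asboolP.
rewrite hw hwf mul0r big_seq big1// => m mum; have rm := um_rm m mum.
rewrite coordsZ//; have [->|/(coset_sum_coords rm) [e We we]] := eqVneq (cf (coset_sum m) w) 0.
  by rewrite mulr0.
case/negP: wum; suff -> : (w * f)%g = m by [].
have mE : m = (w * f * (f^-1 * e))%g by rewrite mulgA mulgK we mulgVK.
have := right_max_unique rf (W0_M (W0_V Wf) We); rewrite -mE => /(_ rm) fe.
by rewrite mE fe mulg1.
Qed.

(** Moving from m to m e^-1 costs v^-L(e) twice: once in the coset sum, and once
    in T_(m e^-1) g, by the left invariance of g. *)
Lemma coset_sum_mul m g : right_max m -> left_invariant g ->
  coset_sum m * g = evz v^-1 poincare_poly *: (T m * g).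
Proof.
move=> rm gl; rewrite evz_poincare_poly /coset_sum mulr_suml scaler_suml.
rewrite big_seq [RHS]big_seq; apply: eq_bigr => e /mem_W0_list We.
rewrite -scalerAl; have := T_ratio m gl (W0_V We).
rewrite {1}(right_max_weight rm We) exprD -scalerA => /(scalerI (vpow_neq0 _)) e1.
rewrite -e1 scalerA; congr (_ *: _).
by rewrite exprVn mul2n -addnn exprD invfM -mulrA mulVf ?mulr1// vpow_neq0.
Qed.


Section Expansion.
Variable A : Qv -> Prop.
Hypothesis A0 : A 0.
Hypothesis AB : forall t1 t2, A t1 -> A t2 -> A (t1 - t2).
Hypothesis AM : forall t1 t2, A t1 -> vle 0 t2 -> A (t1 * t2).

Let A_sum (J : Type) (r : seq J) (P : pred J) (F : J -> Qv) :
  (forall i, P i -> A (F i)) -> A (\sum_(i <- r | P i) F i).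
Proof.
move=> FA; elim/big_ind: _ => // t1 t2 A1 A2.
by rewrite -[t2]opprK -[- t2]sub0r; apply: (AB A1); apply: AB.
Qed.

(** The longest elements in the support of a two-sided invariant element are
    maximal in their double cosets, so subtracting the corresponding multiples of
    the canonical basis leaves a shorter two-sided invariant element. *)
Lemma invariant_expand h : left_invariant h -> right_invariant h ->
  (forall w, A (cf h w)) -> exists r, [/\ coords_spec c h r, forall w, A (r w) &
    forall w, r w != 0 -> double_max w].
Proof.
have [k] : exists k, forall w, cf h w != 0 -> (len w < k)%N.
  have [u [uu ua _]] := coords_seq be h; exists (\max_(w <- u) len w).+1 => w wh.
  have wu : w \in u by apply: contraNT wh => /ua ->.
  by rewrite ltnS (big_rem w)//= leq_maxl.
elim: k h => [|k IH] h hk hl hr hA.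
  have -> : h = 0 by apply: (coords_eq0 be) => w; apply: contrapT => /eqP /hk.
  exists (fun=> 0); split=> [|_|w]; [exact: coords_spec0|exact: A0|].
  by move/eqP.
have [u [uu ua _]] := coords_seq be h.
(* The terms of maximal length k, to be removed first *)
pose uk := [seq w <- u | len w == k].
have ukk w : w \in uk -> len w = k by rewrite mem_filter => /andP [/eqP].
have ukuniq : uniq uk by rewrite filter_uniq.
pose r1 w := if w \in uk then cf h w else 0.
have r1dm w : r1 w != 0 -> double_max w.
  rewrite /r1; case: ifP => [/ukk wk wh|_]; last by rewrite eqxx.
  split=> s S0s; have [Ss _] := S0s.
    have [up|//] := S_len w Ss; have := hk (s * w)%g.
    rewrite (invariant_coords (left_action Ss) (hl _ S0s) up) mulf_neq0 ?vpow_neq0// => /(_ isT).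
    by rewrite up wk ltnn.
  have [up|//] := S_lenr w Ss; have := hk (w * s)%g.
  rewrite (invariant_coords (right_action Ss) (hr _ S0s) up) mulf_neq0 ?vpow_neq0// => /(_ isT).
  by rewrite up wk ltnn.
pose h1 := \sum_(w <- uk) r1 w *: c w.
have spec1 : coords_spec c h1 r1.
  by apply/coords_specP; exists uk; split=> // w /negPf wk; rewrite /r1 wk.
have A1 w : A (r1 w) by rewrite /r1; case: ifP.
have inv1 s : S0 s -> T s * h1 = v ^+ L s *: h1 /\ h1 * T s = v ^+ L s *: h1.
  move=> S0s; rewrite mulr_sumr mulr_suml scaler_sumr; split; apply: eq_bigr => w _.
    have [->|/r1dm [lw _]] := eqVneq (r1 w) 0; first by rewrite !scale0r mulr0 scaler0.
    by rewrite -scalerAr (canonical_left lw S0s) !scalerA mulrC.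
  have [->|/r1dm [_ rw]] := eqVneq (r1 w) 0; first by rewrite !scale0r mul0r scaler0.
  by rewrite -scalerAl (canonical_right rw S0s) !scalerA mulrC.
have [||||r2 [spec2 A2 dm2]] := IH (h - h1).
- move=> w; rewrite coordsB// => wh; rewrite ltnNge; apply/negP => kw; case/eqP: wh.
  have e1 : cf h1 w = r1 w.
    rewrite /h1 coords_sum//; have [wu|wu] := boolP (w \in uk).
      rewrite (bigD1_seq w)//= coordsZ// (proj1 (canonical_coords w)) mulr1.
      rewrite big_seq_cond big1 ?addr0// => w' /andP [/ukk wk' ww'].
      rewrite coordsZ//; have [->|/canonical_triangular [e|l]] := eqVneq (cf (c w') w) 0.
      - by rewrite mulr0.
      - by rewrite e eqxx in ww'.
      - by move: kw l; rewrite wk'; lia.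
    rewrite /r1 (negPf wu) big_seq big1// => w' w'u.
    rewrite coordsZ//; have [->|/canonical_triangular [e|l]] := eqVneq (cf (c w') w) 0.
    - by rewrite mulr0.
    - by rewrite e w'u in wu.
    - by move: kw l; rewrite (ukk w' w'u); lia.
  rewrite e1 /r1; case: ifP => [_|/negbT wu]; rewrite ?subrr// subr0.
  apply: contrapT => /eqP wh; have wk := hk w wh; case/negP: wu; rewrite mem_filter.
  apply/andP; split; first by apply/eqP; lia.
  by apply: contraNT wh => /ua ->.
- by move=> s S0s; have [e1 _] := inv1 s S0s; rewrite mulrBr scalerBr e1 hl.
- by move=> s S0s; have [_ e1] := inv1 s S0s; rewrite mulrBl scalerBr e1 hr.
- move=> w; rewrite coordsB//; apply: AB => //; rewrite /h1 coords_sum//.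
  by apply: A_sum => w' _; rewrite coordsZ//; apply: AM => //; apply: canonical_vle0.
exists (fun w => r2 w + 1 * r1 w); split=> [|w|w].
- by have := coords_spec_lin 1 spec2 spec1; rewrite scale1r subrK.
- by rewrite mul1r -[r1 w]opprK -[- r1 w]sub0r; apply: (AB (A2 w)); apply: AB.
- have [->|/r1dm //] := eqVneq (r1 w) 0; rewrite mulr0 addr0; exact: dm2.
Qed.

End Expansion.

Hypothesis T_bound : forall w w' w'',
  laurent [set n | (n <= N%:Z)%R] (cf (T w * T w') w'').

Lemma product_vle M h g w : (forall y, vle 0 (cf g y)) -> (forall y, vle M (cf h y)) ->
  vle (M + N%:Z) (cf (h * g) w).
Proof.
move=> g0 hM; have [u [_ _ hE]] := coords_seq be h; have [u' [_ _ gE]] := coords_seq be g.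
rewrite {1}hE {1}gE mulr_suml coords_sum//; apply: vle_sum => y _.
rewrite mulr_sumr coords_sum//; apply: vle_sum => y' _.
rewrite -scalerAl -scalerAr !coordsZ//; apply: vleM => //.
by rewrite -[N%:Z]add0r; apply: vleM => //; apply/vle_laurent.
Qed.

(** Splitting c_x into coset sums shows that c_x c_y, hence each structure
    constant r w, is divisible by the Poincare polynomial: r w = pi_bal t with t a
    Laurent polynomial, bar-invariant since r w and pi_bal are.  The bound on
    products of standard basis elements puts r w in v^N Z[v^-1], and pi_bal is v^N
    times a polynomial in v^-1 with constant term 1, so t lies in Z[v^-1].  Being
    bar-invariant, t is an integer, namely the coefficient of v^N in r w. *)
Lemma double_max_product x y : double_max x -> double_max y ->
  exists r, [/\ coords_spec c (c x * c y) r, forall w, r w != 0 -> double_max w &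
    forall w, r w = pi_bal * (laurent_coef (r w) N%:Z)%:~R].
Proof.
move=> [lx rx] [ly ry]; set h := c x * c y.
have vh w : vle N%:Z (cf h w).
  by rewrite -[N%:Z]add0r; apply: product_vle => z; apply: canonical_vle0.
have [u urm cxE] := right_invariant_expand (canonical_right rx).
pose P' := evz v^-1 poincare_poly.
pose g := \sum_(m <- u) cf (c x) m *: (T m * c y).
have hE : h = P' *: g.
  rewrite /h {1}cxE mulr_suml scaler_sumr big_seq [RHS]big_seq; apply: eq_bigr => m /urm rm.
  by rewrite -scalerAl (coset_sum_mul rm (canonical_left ly)) !scalerA mulrC.
have vg w : laurent_poly (cf g w).
  exists N%:Z; rewrite coords_sum//; apply: vle_sum => m _; rewrite coordsZ//.
  rewrite -[N%:Z]add0r; apply: vleM; first exact: canonical_vle0.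
  rewrite -[N%:Z]add0r; apply: product_vle => z; first exact: canonical_vle0.
  by rewrite coords_gen//; case: eqP => _; [exact: vle1|exact: vle0].
(* Both the bound and the divisibility pass from the coefficients of h in the
   standard basis to those in the canonical basis *)
pose A t := vle N%:Z t /\ exists2 t', laurent_poly t' & t = P' * t'.
have A0 : A 0 by split; [exact: vle0|exists 0; rewrite ?mulr0//; exists 0; exact: vle0].
have AB t1 t2 : A t1 -> A t2 -> A (t1 - t2).
  move=> [v1 [t1' l1 e1]] [v2 [t2' l2 e2]]; split; first exact: vleB.
  by exists (t1' - t2'); [exact: laurent_polyB|rewrite mulrBr -e1 -e2].
have AM t1 t2 : A t1 -> vle 0 t2 -> A (t1 * t2).
  move=> [v1 [t1' l1 e1]] v2; split; first by rewrite -[N%:Z]addr0; apply: vleM.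
  by exists (t1' * t2); [apply: laurent_polyM => //; exists 0|rewrite mulrA -e1].
have hl : left_invariant h by move=> s S0s; rewrite /h mulrA (canonical_left lx S0s) scalerAl.
have hr : right_invariant h by move=> s S0s; rewrite /h -mulrA (canonical_right ry S0s) scalerAr.
have hA w : A (cf h w) by split=> //; exists (cf g w) => //; rewrite hE coordsZ.
have [r [rspec rA rdm]] := invariant_expand A0 AB AM hl hr hA.
have rlau w : laurent_poly (r w) by exists N%:Z; case: (rA w).
pose r' w := projT1 (cid (bar_laurent (rlau w))).
have r'E w : bar (r w)%:A = (r' w)%:A by rewrite /r'; case: cid.
have r'spec : coords_spec c h r'.
  have [ur [uu ua hr']] := (proj1 (coords_specP c h r)) rspec; apply/coords_specP; exists ur; split=> //.
    move=> w /ua rw0; apply: alg_inj.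
    by rewrite -r'E rw0 !scale0r rmorph0.
  have hb : bar h = h by rewrite /h rmorphM/= !bar_c.
  rewrite -hb {1}hr' rmorph_sum; apply: eq_bigr => w _ /=.
  by rewrite (bar_scale _ (r'E w)) bar_c.
have rr' : r' = r by apply: (canonical_indep r'spec rspec).
exists r; split=> // w; have [vr [t' lt' rE]] := rA w.
pose t := v ^ (- N%:Z) * t'.
have rt : r w = pi_bal * t.
  rewrite rE /pi_bal /t mulrACA mulrCA -mulrA; congr (_ * _).
  by rewrite mulrA -exprzDr ?v_unit// subrr expr0z mul1r.
have lt : laurent_poly t by apply: laurent_polyM => //; exists (- N%:Z); exact: vle_pow.
have [k tk] : exists k : int, t = k%:~R.
  apply: bar_int.
    apply: (vle_divide poincare_poly0 lt).
    have -> : evz v^-1 poincare_poly * t = v ^ (- N%:Z) * r w.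
      by rewrite rE /t mulrCA.
    by rewrite -(addNr N%:Z); apply: vleM => //; exact: vle_pow.
  have [t3 bt3] := bar_laurent lt; rewrite bt3; congr (_ *: _).
  apply: (mulfI pi_bal_neq0); apply: alg_inj.
  rewrite -rt -[in RHS]rr' -r'E rt.
  have A' (a b : Qv) : ((a * b)%:A : H) = a%:A * b%:A by rewrite -scalerAl mul1r scalerA.
  by rewrite (A' pi_bal t3) (A' pi_bal t) rmorphM/= bar_pi_bal bt3.
have kE : laurent_coef (r w) N%:Z = k.
  rewrite rt tk /pi_bal -mulrA -(evzC v^-1) -evzM laurent_coef_evz.
  by rewrite coefMC poincare_poly0 mul1r.
by rewrite kE -tk.
Qed.


(** ** The structure constants *)

Local Notation Mx := (Mmax S s0).
Local Notation Qp := (Qplus S s0).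
Local Notation cb := (cbold S s0 L c).
Local Notation NN := (Nint S s0 L c).

Lemma cboldE x : cb x = pi_bal^-1 *: c (Mx x).
Proof.
rewrite /cbold pi_balE; congr (_ *: _).
by rewrite -exprnP invfM mulrA mulfV ?mul1r// vpow_neq0.
Qed.

Lemma Mmax_double_max x : double_max (Mx x).
Proof. by have [_ [_ [_ _ _]]] := Mmax_double x. Qed.

Lemma Mmax_bij : set_bij Qp [set w | double_max w] Mx.
Proof.
split=> [x _|x y|w].
- exact: Mmax_double_max.
- by rewrite !inE; apply: Mmax_inj.
- by move=> /double_max_Qplus [z Qz ->]; exists z.
Qed.

Lemma sum_double_max (V : zmodType) (F : W -> V) : (forall w, ~ double_max w -> F w = 0) ->
  \sum_(w \in [set: W]) F w = \sum_(z \in Qp) F (Mx z).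
Proof.
move=> F0; rewrite -(reindex_fsbig _ _ _ _ Mmax_bij); apply/esym.
by apply: fsbig_widen => // w [_ /= nw]; apply: F0.
Qed.

Definition Mmax_inv w : W := xget 1%g [set z | Qp z /\ Mx z = w].

Lemma Mmax_invK z : Qp z -> Mmax_inv (Mx z) = z.
Proof.
move=> Qz; have [Qz' e] : Qp (Mmax_inv (Mx z)) /\ Mx (Mmax_inv (Mx z)) = Mx z.
  by apply: (@xgetPex _ 1%g [set z' | Qp z' /\ Mx z' = Mx z]); exists z.
exact: Mmax_inj.
Qed.

Lemma finsupp_Mmax (V : nmodType) (a : W -> V) : finsupp_on [set: W] a ->
  finsupp_on Qp (fun z => a (Mx z)).
Proof.
move=> fa; apply: (sub_finite_set _ (finite_image Mmax_inv fa)) => z [Qz /= az].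
by exists (Mx z); [split|exact: Mmax_invK].
Qed.

Lemma Nint_spec x y (r := NN (Mx x) (Mx y)) :
  [/\ finsupp_on [set: W] r, forall w, ~ double_max w -> r w = 0 &
    coords_spec c (c (Mx x) * c (Mx y)) (fun w => pi_bal * (r w)%:~R)].
Proof.
have [r' [spec rdm rE]] := double_max_product (Mmax_double_max x) (Mmax_double_max y).
have hE : coords c (c (Mx x) * c (Mx y)) = r' := coords_unique canonical_indep spec.
have rr w : r w = laurent_coef (r' w) N%:Z by rewrite /r /Nint /hcoef hE.
have r0 w : r' w = 0 -> r w = 0.
  move=> w0; have := rE w; rewrite -rr w0 => /esym/eqP.
  by rewrite mulf_eq0 (negPf pi_bal_neq0) /= v_intr_eq0 => /eqP.
split.
- have [fr _] := spec; apply: sub_finite_set fr => w [_ /= rw]; split=> //=.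
  by apply: contraNN rw => /eqP /r0 ->.
- move=> w nw; apply: r0; apply: contrapT => /eqP /rdm; exact: nw.
- rewrite (_ : (fun w => _) = r') //; apply: funext => w.
  by rewrite rr -rE.
Qed.

(** The factor pi_bal of the structure constants cancels against one of the two
    normalising factors pi_bal^-1 on the left. *)
Lemma cbold_mul x y :
  finsupp_on Qp (fun z => NN (Mx x) (Mx y) (Mx z)) /\
  cb x * cb y = \sum_(z \in Qp) (cb z *~ NN (Mx x) (Mx y) (Mx z)).
Proof.
have [fr rdm /coords_specP [u [uu ua hE]]] := Nint_spec x y.
split; first exact: finsupp_Mmax.
set r := NN (Mx x) (Mx y) in fr rdm ua hE *.
pose F w : H := (pi_bal^-1 *: c w) *~ r w.
have F0 w : ~ double_max w -> F w = 0 by move=> /rdm rw; rewrite /F rw mulr0z.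
have -> : \sum_(z \in Qp) (cb z *~ r (Mx z)) = \sum_(z \in Qp) F (Mx z).
  by apply: eq_fsbigr => z _; rewrite cboldE.
rewrite -(sum_double_max F0).
rewrite !cboldE -scalerAl -scalerAr hE (@fsum_seq _ _ _ _ u)//; last first.
  move=> w _ /ua /eqP; rewrite mulf_eq0 (negPf pi_bal_neq0) v_intr_eq0 /= => /eqP rw.
  by rewrite /F rw mulr0z.
rewrite !scaler_sumr; apply: eq_bigr => w _.
rewrite /F !scalerA -scaler_int scalerA; congr (_ *: _).
by rewrite -mulrA mulKf ?pi_bal_neq0// mulrC.
Qed.

Lemma cbold_free : Zfree Qp cb.
Proof.
move=> a fa; have [u uu uE] := finsupp_seq fa.
have uQ z : z \in u -> Qp z by move=> /uE [].
rewrite (@fsum_seq _ _ _ _ u)// => [e0|i Qi iu]; last first.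
  have -> : a i = 0; last by rewrite mulr0z.
  by apply/eqP; apply: contraNT iu => ai; apply/uE.
pose b w : Qv := if w \in [seq Mx z | z <- u] then pi_bal^-1 * (a (Mmax_inv w))%:~R else 0.
have bspec : coords_spec c 0 b.
  apply/coords_specP; exists [seq Mx z | z <- u]; split.
  - by rewrite map_inj_in_uniq// => z z' /uQ Qz /uQ Qz'; apply: Mmax_inj.
  - by move=> w /negPf wu; rewrite /b wu.
  rewrite -[LHS]e0 big_map big_seq [RHS]big_seq; apply: eq_bigr => z zu.
  rewrite /b map_f// Mmax_invK ?cboldE; last exact: uQ.
  by rewrite -scaler_int scalerA mulrC.
have b0 : b = fun=> 0 := canonical_indep bspec (coords_spec0 c).
move=> z Qz; apply: contrapT => /eqP az; have zu : z \in u by apply/uE.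
have := congr1 (fun f => f (Mx z)) b0; rewrite /b map_f// Mmax_invK// => /eqP.
rewrite mulf_eq0 invr_eq0 (negPf pi_bal_neq0) v_intr_eq0 /=.
by rewrite (negPf az).
Qed.

Lemma tau_Mmax_free : Zfree Qp (fun x => tau (Mx x)).
Proof.
move=> a fa; have [u uu uE] := finsupp_seq fa.
rewrite (@fsum_seq _ _ _ _ u)// => [a0 z Qz|i|i Qi iu]; last 2 first.
- by move=> /uE [].
- have -> : a i = 0; last by rewrite mulr0z.
  by apply/eqP; apply: contraNT iu => ai; apply/uE.
apply: contrapT => /eqP az; have zu : z \in u by apply/uE.
have := congr1 (coeff (Mx z)) a0.
rewrite raddf_sum coeff0 (bigD1_seq z)//= coeff_tau_mulz eqxx mul1r big_seq_cond big1 ?addr0.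
  by move=> /eqP; rewrite (negPf az).
move=> y /andP [/uE [Qy _] yz]; rewrite coeff_tau_mulz.
case: eqP => [/(Mmax_inj Qy Qz) e|]; last by rewrite mul0r.
by rewrite e eqxx in yz.
Qed.

Local Notation RR := (Rsub S s0 L c).
Local Notation phi := (Zmap Qp cb (fun x => tau (Mx x))).

Lemma RsubM a b : RR a -> RR b -> RR (a * b).
Proof.
move=> Ra Rb; move: a Ra; apply: Zspan_min => [|x y Rx Ry|x Qx].
- by rewrite mul0r; apply: Zspan0.
- by rewrite mulrBl; apply: ZspanB.
move: b Rb; apply: Zspan_min => [|x' y Rx Ry|y Qy].
- by rewrite mulr0; apply: Zspan0.
- by rewrite mulrBr; apply: ZspanB.
have [fr ->] := cbold_mul x y.
by exists (fun z => NN (Mx x) (Mx y) (Mx z)).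
Qed.

Lemma Jmul_Mmax x y : Jmul NN (tau (Mx x)) (tau (Mx y)) =
  \sum_(z \in Qp) (tau (Mx z) *~ NN (Mx x) (Mx y) (Mx z)).
Proof.
have [_ rdm _] := Nint_spec x y.
rewrite Jmul_tau /Jcoef (@sum_double_max _ (fun w => tau w *~ NN (Mx x) (Mx y) w))//.
by move=> w /rdm ->; rewrite mulr0z.
Qed.

Lemma phi_mul a b : RR a -> RR b -> phi (a * b) = Jmul NN (phi a) (phi b).
Proof.
pose K b a := RR a /\ phi (a * b) = Jmul NN (phi a) (phi b).
have K0 b' : K b' 0.
  by split; [apply: Zspan0|rewrite mul0r (Zmap0 _ cbold_free) Jmul0l].
have KB b' h1 h2 : RR b' -> K b' h1 -> K b' h2 -> K b' (h1 - h2).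
  move=> Rb [Rx xE] [Ry yE]; split; first exact: ZspanB.
  rewrite mulrBl !(ZmapB _ cbold_free)//; try exact: RsubM.
  by rewrite xE yE JmulBl.
move=> Ra Rb; suff [//] : K b a; move: a Ra; apply: Zspan_min => // [x y|x Qx].
  exact: KB.
split; first exact: Zspan_gen.
suff [] : RR b /\ phi (cb x * b) = Jmul NN (phi (cb x)) (phi b) by [].
have Rx : RR (cb x) by exact: Zspan_gen.
move: b Rb; apply: Zspan_min => [|y z [Ry yE] [Rz zE]|y Qy].
- by split; [apply: Zspan0|rewrite mulr0 (Zmap0 _ cbold_free) Jmul0r].
- split; first exact: ZspanB.
  rewrite mulrBr !(ZmapB _ cbold_free)//; try exact: RsubM.
  by rewrite yE zE JmulBr.
split; first exact: Zspan_gen.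
have [fr ->] := cbold_mul x y.
by rewrite (ZmapE _ cbold_free fr) !(Zmap_gen _ cbold_free)// Jmul_Mmax.
Qed.

Lemma Jstar_assoc a b d : Jstar S s0 a -> Jstar S s0 b -> Jstar S s0 d ->
  Jmul NN (Jmul NN a b) d = Jmul NN a (Jmul NN b d).
Proof.
have [_ _ surj] := Zmap_bij cbold_free tau_Mmax_free.
move=> /surj [a' Ra <-] /surj [b' Rb <-] /surj [d' Rd <-].
rewrite -!phi_mul//; try exact: RsubM.
by rewrite mulrA.
Qed.

End Hecke.

Theorem theorem1p5 (R : realType) (W : groupType) (S : set W)
    (hW : irreducible_affine_weyl_group R S)
    (s0 : W) (hs0 : special S s0)
    (L : W -> nat) (hL : weight_function S L)
    (hLpos : forall s, S s -> (0 < L s)%N)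
    (H : algType Qv) (T : W -> H) (hH : hecke_algebra S L T)
    (bar : {rmorphism H -> H}) (hbar : bar_involution T bar)
    (c : W -> H) (hc : forall w, canonical_element T bar w (c w))
    (* T_w T_w' lies in v^{L(M_0)} \sum_{w''} Z[v^-1] T_{w''}; this can fail if
       L takes a larger value at s0 than at another special element of S *)
    (hbound : forall w w' w'',
      laurent [set n | n <= (L (Mmax S s0 1%g))%:Z] (coords T (T w * T w') w'')) :
  [/\ (* (a) *)
      forall x y, Qplus S s0 x -> Qplus S s0 y ->
        let N z := Nint S s0 L c (Mmax S s0 x) (Mmax S s0 y) (Mmax S s0 z) in
        finsupp_on (Qplus S s0) N /\
        cbold S s0 L c x * cbold S s0 L c y
          = \sum_(z \in Qplus S s0) (cbold S s0 L c z *~ N z),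
      (* (b) *)
      Zfree (Qplus S s0) (cbold S s0 L c) /\
      (forall a b, Rsub S s0 L c a -> Rsub S s0 L c b -> Rsub S s0 L c (a * b)),
      (* (c) *)
      exists phi : H -> Jgroup W,
        [/\ set_bij (Rsub S s0 L c) (Jstar S s0) phi,
            forall a b, Rsub S s0 L c a -> Rsub S s0 L c b ->
              phi (a + b) = phi a + phi b,
            forall x, Qplus S s0 x -> phi (cbold S s0 L c x) = tau (Mmax S s0 x) &
            forall a b, Rsub S s0 L c a -> Rsub S s0 L c b ->
              phi (a * b) = Jmul (Nint S s0 L c) (phi a) (phi b)] &
      forall a b d, Jstar S s0 a -> Jstar S s0 b -> Jstar S s0 d ->
        Jmul (Nint S s0 L c) (Jmul (Nint S s0 L c) a b) d
          = Jmul (Nint S s0 L c) a (Jmul (Nint S s0 L c) b d)].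
Proof.
have sd := affine_special_data hW hs0.
have inv := sd_inv sd; have gen := sd_gen sd; have slen := sd_len sd.
pose K := cbold_mul inv gen slen hL hLpos hH hbar hc sd hbound.
have free := cbold_free inv gen slen hL hLpos hH hbar hc sd.
have tfree := tau_Mmax_free inv gen slen hL hLpos hH hbar hc sd.
split.
- by move=> x y _ _; apply: K.
- split=> //; exact: (RsubM inv gen slen hL hLpos hH hbar hc sd hbound).
- exists (Zmap (Qplus S s0) (cbold S s0 L c) (fun x => tau (Mmax S s0 x))); split.
  + exact: Zmap_bij.
  + by move=> a b; apply: ZmapD.
  + by move=> x Qx; rewrite Zmap_gen.
  + exact: (phi_mul inv gen slen hL hLpos hH hbar hc sd hbound).
- exact: (Jstar_assoc inv gen slen hL hLpos hH hbar hc sd hbound).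
Qed.
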